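(* Let $d\ge1$, $\nu>0$, $\mu>0$, and let $\mathbf{T}_1,\mathbf{T}_2$ be independent random vectors in $\mathbb{R}^d$ with Student densities $f_\nu$ and $f_\mu$ respectively, where $f_\nu(\mathbf{t})=\frac{\Gamma(\nu+\frac d2)}{\Gamma(\nu)\pi^{d/2}}(1+\Vert\mathbf{t}\Vert^2)^{-\nu-\frac d2}$. Then the density of $\mathbf{Y}=\mathbf{T}_1+\mathbf{T}_2$ is \[ f_{\mathbf{Y}}(\mathbf{x})=\sum_{n=0}^\infty c_n^{(\nu,\mu)}\phi_{n,\nu+\mu}(\mathbf{x}),\qquad\mathbf{x}\in\mathbb{R}^d, \] where \[ c_n^{(\nu,\mu)}=\frac{1}{B(\nu,\mu)}\frac{(\frac d2)_n}{n!}\int_0^1 t^{\mu+\frac d2-1}(1-t)^{\nu+\frac d2-1}(1-t+t^2)^n\,dt,\qquad n\ge0, \] are positive coefficients with $\sum_n c_n^{(\nu,\mu)}=1$.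
   Context: For $\eta>0$ and $n\in\mathbb{N}$, $\phi_{n,\eta}$ is the probability density on $\mathbb{R}^d$ \[ \phi_{n,\eta}(\mathbf{x})=\frac{\Gamma(\frac d2)}{\pi^{d/2}B(\eta,n+\frac d2)}\frac{\Vert\mathbf{x}\Vert^{2n}}{(1+\Vert\mathbf{x}\Vert^2)^{\eta+n+\frac d2}}. \] $B$ is the Beta function and $(a)_n=a(a+1)\cdots(a+n-1)$ is the Pochhammer symbol. $f_\nu$ is the Student density with $2\nu$ degrees of freedom. *)

(* Defs.v *)
From HB Require Import structures.
From mathcomp Require Import all_boot all_order all_algebra.
From mathcomp Require Import all_classical all_reals all_analysis.
Set Implicit Arguments. Unset Strict Implicit. Unset Printing Implicit Defensive.
Import Order.TTheory GRing.Theory Num.Theory.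
Import numFieldNormedType.Exports.
Local Open Scope classical_set_scope.
Local Open Scope ring_scope.

Section Defs.
Variable R : realType.
Local Notation mu := (@lebesgue_measure R).

Definition Gammaf (s : R) : R :=
  Rintegral mu `]0, +oo[ (fun t => t `^ (s - 1) * expR (- t)).

Definition Betaf (a b : R) : R :=
  Rintegral mu `]0, 1[ (fun t => t `^ (a - 1) * (1 - t) `^ (b - 1)).

Definition pochhammer (a : R) (n : nat) : R := \prod_(i < n) (a + i%:R).

Definition sqnorm (d : nat) (x : 'rV[R]_d) : R := \sum_(i < d) x 0 i ^+ 2.

(* Borel sets of R^d: sigma-algebra generated by the open sets
   (of the product topology, i.e. the Euclidean topology) *)
Definition borel_Rd (d : nat) : set (set 'rV[R]_d) := <<s @open 'rV[R]_d >>.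

(* Lebesgue integral over R^d of a nonnegative function, as the iterated
   integral of one-dimensional Lebesgue integrals (Tonelli) *)
Fixpoint integral_Rd (d : nat) : ('rV[R]_d -> \bar R) -> \bar R :=
  match d return ('rV[R]_d -> \bar R) -> \bar R with
  | 0 => fun f => f 0
  | d'.+1 => fun f =>
      (\int[mu]_x integral_Rd (fun v : 'rV[R]_d' =>
          f (row_mx (const_mx x : 'rV[R]_1) v)))%E
  end.

Definition has_density_Rd (d0 : measure_display) (Omega : measurableType d0)
  (P : probability Omega R) (d : nat) (X : Omega -> 'rV[R]_d)
  (f : 'rV[R]_d -> R) : Prop :=
  (forall A, borel_Rd A -> measurable (X @^-1` A)) /\
  (forall A, borel_Rd A ->
     P (X @^-1` A) = integral_Rd (fun x => (\1_A x * f x)%:E)).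

Definition independent_Rd (d0 : measure_display) (Omega : measurableType d0)
  (P : probability Omega R) (d : nat) (X Y : Omega -> 'rV[R]_d) : Prop :=
  forall A B, borel_Rd A -> borel_Rd B ->
    P (X @^-1` A `&` Y @^-1` B) = (P (X @^-1` A) * P (Y @^-1` B))%E.

(* Student density f_nu on R^d (2 nu degrees of freedom) *)
Definition student (d : nat) (nu : R) (t : 'rV[R]_d) : R :=
  Gammaf (nu + d%:R / 2) / (Gammaf nu * pi `^ (d%:R / 2))
  * (1 + sqnorm t) `^ (- nu - d%:R / 2).

Definition phi (d n : nat) (eta : R) (x : 'rV[R]_d) : R :=
  Gammaf (d%:R / 2) / (pi `^ (d%:R / 2) * Betaf eta (n%:R + d%:R / 2))
  * (sqnorm x ^+ n / (1 + sqnorm x) `^ (eta + n%:R + d%:R / 2)).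

Definition coef (d : nat) (nu mu' : R) (n : nat) : R :=
  1 / Betaf nu mu' * (pochhammer (d%:R / 2) n / n`!%:R)
  * Rintegral mu `[0, 1] (fun t => t `^ (mu' + d%:R / 2 - 1)
        * (1 - t) `^ (nu + d%:R / 2 - 1) * (1 - t + t ^+ 2) ^+ n).

End Defs.

Arguments student {R} d nu t.
Arguments phi {R} d n eta x.
Arguments coef {R} d nu mu' n.

(* Main.v *)
(* Student densities are Gamma mixtures of Gaussians,
     Gamma(a) (1 + |t|^2)^(-a) = int_0^oo s^(a-1) exp(-(1 + |t|^2) s) ds.
   By Tonelli, the convolution of two of them is a mixture, over the two mixing
   variables (s, u), of the explicit Gaussian convolutions.  The substitution
   (s, u) = (l (1 - t), l t) and the l-integral leave a constant times
     int_0^1 t^(mu+d/2-1) (1-t)^(nu+d/2-1) (1 + t (1-t) |x|^2)^(-(nu+mu+d/2)) dt.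
   Since 1 + t (1-t) |x|^2 = (1 + |x|^2) - |x|^2 (1 - t + t^2), expanding the
   last factor as a negative binomial series gives the mixture of the phi_n.
   The coefficients sum to 1 by the same series with exponent -d/2, because
   1 - (1 - t + t^2) = t (1 - t). *)
Require Import Defs.
From HB Require Import structures.
From mathcomp Require Import all_boot all_order all_algebra.
From mathcomp Require Import all_classical all_reals all_analysis.
From mathcomp Require Import measurable_realfun ring lra.
Set Implicit Arguments. Unset Strict Implicit. Unset Printing Implicit Defensive.
Import Order.TTheory GRing.Theory Num.Theory.
Import numFieldNormedType.Exports.
Local Open Scope classical_set_scope.
Local Open Scope ring_scope.

(** * Affine changes of variables *)

Section affine.
Local Open Scope ereal_scope.
Variable R : realType.
Local Notation leb := (@lebesgue_measure R).

(** All integrands are nonnegative, so the computation takes place in the extended reals, where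
    Tonelli's theorem and monotone convergence need no integrability. Finiteness matters only where
    [fine] occurs: in [Gammaf], [Betaf], the integral of [coef], and the return to real series. It
    is drawn from the substitution itself: Gamma(a) Gamma(b) = Gamma(a + b) B(b, a) holds with
    infinite values allowed, its case a = 1 gives the functional equation, and from there Gamma and
    then Beta are seen to be finite. Integration over R^d is by definition an iterated integral,
    whereas laws and independence concern the Borel sets generated by the open sets. Measurability
    of partial integrals, Tonelli and translation invariance are therefore proved by induction on
    the dimension. The strict inequality 1 - t + t^2 < 1 on []0, 1[] lets one series lemma cover
    both the density and the limiting case that gives the total mass of the coefficients. *)

Lemma lebesgue_measure_shift (b : R) (A : set R) : measurable A ->
  pushforward leb (fun x => x + b : measurableTypeR R)%R A = leb A.
Proof.
move=> mA; apply/esym.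
have mf : measurable_fun [set: R] (fun x => x + b : measurableTypeR R)%R.
  exact: measurable_funD.
pose f : {mfun _ >-> _} :=
  HB.pack (fun x => x + b : measurableTypeR R)%R (isMeasurableFun.Build _ _ _ _ _ mf).
(* Lebesgue measure is determined by its values on the intervals []a, c]], so only these are
   compared. *)
apply: (@lebesgue_measure_unique _ (pushforward leb f)) => // _ [[a c]] _ <-.
rewrite /pushforward /=.
rewrite [X in _ = leb X](_ : _ = `](a - b)%R, (c - b)%R]%classic); last first.
  apply/seteqP; split=> x /=; rewrite !in_itv/=; lra.
rewrite !lebesgue_measure_itv/= !lte_fin ltrD2r.
by case: ifP => // _; rewrite -!EFinB; congr EFin; lra.
Qed.

Lemma lebesgue_measure_scale (c : R) (A : set R) : (0 < c)%R -> measurable A ->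
  c%:E * pushforward leb (fun x => c * x : measurableTypeR R)%R A = leb A.
Proof.
move=> c0 mA; apply/esym.
have mf : measurable_fun [set: R] (fun x => c * x : measurableTypeR R)%R.
  exact: measurable_funM.
pose f : {mfun _ >-> _} :=
  HB.pack (fun x => c * x : measurableTypeR R)%R (isMeasurableFun.Build _ _ _ _ _ mf).
pose k : {nonneg R} := NngNum (ltW c0).
apply: (@lebesgue_measure_unique _ (mscale k (pushforward leb f))) => // _ [[a b]] _ <-.
rewrite /mscale/= /pushforward /=.
rewrite [X in _ = _ * leb X](_ : _ = `](a / c)%R, (b / c)%R]%classic); last first.
  by apply/seteqP; split=> x /=; rewrite !in_itv/= ltr_pdivrMr// ler_pdivlMr// mulrC.
rewrite !lebesgue_measure_itv/= !lte_fin ltr_pM2r ?invr_gt0//.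
case: ifP => // _; rewrite ?mule0//.
by rewrite -!EFinB -EFinM; congr EFin; field; rewrite gt_eqF.
Qed.

Lemma ge0_integral_shift (b : R) (f : R -> \bar R) :
  measurable_fun [set: R] f -> (forall x, 0 <= f x) ->
  \int[leb]_x f (x + b)%R = \int[leb]_x f x.
Proof.
move=> mf f0.
have mg : measurable_fun [set: R] (fun x => x + b : measurableTypeR R)%R.
  exact: measurable_funD.
rewrite [RHS](_ : _ = \int[pushforward leb (fun x => x + b : measurableTypeR R)%R]_x f x).
  by rewrite ge0_integral_pushforward.
apply: eq_measure_integral => A mA _.
exact/esym/lebesgue_measure_shift.
Qed.

Lemma ge0_integral_scale (c : R) (f : R -> \bar R) : (0 < c)%R ->
  measurable_fun [set: R] f -> (forall x, 0 <= f x) ->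
  c%:E * \int[leb]_x f (c * x)%R = \int[leb]_x f x.
Proof.
move=> c0 mf f0.
have mg : measurable_fun [set: R] (fun x => c * x : measurableTypeR R)%R.
  exact: measurable_funM.
pose g : {mfun _ >-> _} :=
  HB.pack (fun x => c * x : measurableTypeR R)%R (isMeasurableFun.Build _ _ _ _ _ mg).
pose k : {nonneg R} := NngNum (ltW c0).
rewrite [RHS](_ : _ = \int[mscale k (pushforward leb g)]_x f x).
  by rewrite ge0_integral_mscale//= ge0_integral_pushforward.
apply: eq_measure_integral => A mA _.
exact/esym/(lebesgue_measure_scale c0).
Qed.

End affine.

(** * Gamma and Beta integrals *)

Section gamma.
Local Open Scope ereal_scope.
Variable R : realType.
Local Notation leb := (@lebesgue_measure R).

(* Extending by 0 lets every integral below range over the whole line. *)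
Definition pw (a s : R) : R := if (0 < s)%R then (s `^ (a - 1))%R else 0%R.

Lemma pw_ge0 a s : (0 <= pw a s)%R.
Proof. by rewrite /pw; case: ifP => // _; exact: powR_ge0. Qed.

Lemma pw_gt0E a s : (0 < s)%R -> pw a s = (s `^ (a - 1))%R.
Proof. by rewrite /pw => ->. Qed.

Lemma pw_le0E a s : (s <= 0)%R -> pw a s = 0%R.
Proof. by rewrite /pw leNgt => /negbTE ->. Qed.

Lemma measurable_pw a : measurable_fun [set: R] (pw a).
Proof.
by apply: measurable_fun_ifT => //; exact: measurable_fun_ltr.
Qed.

Lemma pw_scale a c s : (0 < c)%R -> pw a (c * s) = (c `^ (a - 1) * pw a s)%R.
Proof.
move=> c0; have [s0|s0] := ltP 0%R s.
  by rewrite !pw_gt0E ?mulr_gt0// powRM ?ltW.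
by rewrite !pw_le0E ?mulr0// pmulr_rle0.
Qed.

Lemma pwM a b s : (pw a s * pw b s = pw (a + b - 1) s)%R.
Proof.
have [s0|s0] := ltP 0%R s; last by rewrite !pw_le0E ?mulr0.
rewrite !pw_gt0E// -powRD; last by rewrite (gt_eqF s0) implybT.
by congr (_ `^ _)%R; lra.
Qed.

Lemma pwX a n s : (pw a s * s ^+ n = pw (a + n%:R) s)%R.
Proof.
have [s0|s0] := ltP 0%R s; last by rewrite !pw_le0E ?mul0r.
rewrite !pw_gt0E// -powR_mulrn ?ltW// -powRD; last by rewrite (gt_eqF s0) implybT.
by congr (_ `^ _)%R; lra.
Qed.

(** Extended-real forms. [Gammaf] and [Betaf] pass through [fine], which sends an infinite integral
    to 0, so identities are proved for these first and carried over once finiteness is known. *)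
Definition GammaE a := \int[leb]_s (pw a s * expR (- s))%:E.
Definition BetaE a b := \int[leb]_t (pw a t * pw b (1 - t))%:E.

Lemma GammafE a : Gammaf a = fine (GammaE a).
Proof.
rewrite /Gammaf /Rintegral /GammaE [in LHS]integral_mkcond; congr fine.
apply: eq_integral => s _; rewrite patchE/=.
case: ifPn => [|/negP]; rewrite inE/= in_itv/= andbT => s0; first by rewrite pw_gt0E.
by rewrite pw_le0E ?mul0r// leNgt; exact/negP.
Qed.

Lemma BetafE a b : Betaf a b = fine (BetaE a b).
Proof.
rewrite /Betaf /Rintegral /BetaE [in LHS]integral_mkcond; congr fine.
apply: eq_integral => t _; rewrite patchE/=.
case: ifPn => [|/negP]; rewrite inE/= in_itv/=.
  by move=> /andP[t0 t1]; rewrite !pw_gt0E// subr_gt0.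
move=> /negP; rewrite negb_and -!leNgt => /orP[t0|t1].
  by rewrite pw_le0E ?mul0r.
by rewrite [pw b _]pw_le0E ?mulr0// subr_le0.
Qed.

Lemma measurable_pw_comp d0 (T : measurableType d0) a (f : T -> R) :
  measurable_fun [set: T] f -> measurable_fun [set: T] (fun t => pw a (f t)).
Proof. by move=> mf; apply: (measurableT_comp (measurable_pw a)). Qed.

Lemma measurable_pw_expR a : measurable_fun [set: R] (fun s => (pw a s * expR (- s))%:E).
Proof.
apply/measurable_EFinP; apply: measurable_funM; first exact: measurable_pw.
by apply: measurableT_comp => //; exact: measurable_funN.
Qed.

Lemma measurable_pw_onem a b :
  measurable_fun [set: R] (fun t => (pw a t * pw b (1 - t))%R).
Proof.
apply: measurable_funM; first exact: measurable_pw.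
by apply: measurable_pw_comp; exact: measurable_funB.
Qed.

Lemma integral_pw_expR a c : (0 < c)%R ->
  \int[leb]_s (pw a s * expR (- (c * s)))%:E = (c `^ (- a))%:E * GammaE a.
Proof.
move=> c0; rewrite /GammaE -[X in _ = _ * X](ge0_integral_scale c0); last 2 first.
- exact: measurable_pw_expR.
- by move=> s; rewrite lee_fin mulr_ge0 ?pw_ge0 ?expR_ge0.
under [in RHS]eq_integral do rewrite pw_scale// -mulrA EFinM.
rewrite ge0_integralZl//; last 3 first.
- apply/measurable_EFinP; apply: measurable_funM; first exact: measurable_pw.
  by apply: measurableT_comp => //; apply: measurable_funN; exact: measurable_funM.
- by move=> s _; rewrite lee_fin mulr_ge0 ?pw_ge0 ?expR_ge0.
- by rewrite lee_fin powR_ge0.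
rewrite !muleA -!EFinM (mulrAC _ c) -powRD ?(gt_eqF c0) ?implybT//.
rewrite (_ : (- a + (a - 1) = - 1)%R); last by lra.
by rewrite powR_inv1 ?ltW// mulVf ?mul1e// gt_eqF.
Qed.

(* The substitution (s, u) = (l (1 - t), l t), split into the shift s = l - u
   and, for fixed l, the scaling u = l t. *)
Lemma integral_pw_polar a b (K : R * R -> \bar R) :
  measurable_fun [set: R * R] K -> (forall p, 0 <= K p) ->
  \int[leb]_u \int[leb]_s ((pw a s * pw b u)%:E * K (s, u)) =
  \int[leb]_l ((pw (a + b) l)%:E *
    \int[leb]_t ((pw b t * pw a (1 - t))%:E * K (l - l * t, l * t)%R)).
Proof.
move=> mK K0.
pose H (s u : R) := (pw a s * pw b u)%:E * K (s, u).
have H0 s u : 0 <= H s u by rewrite mule_ge0// lee_fin mulr_ge0 ?pw_ge0.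
have mH d0 (T : measurableType d0) (f g : T -> R) : measurable_fun setT f ->
    measurable_fun setT g -> measurable_fun setT (fun t => H (f t) (g t)).
  move=> mf mg; apply: emeasurable_funM.
    apply/measurable_EFinP.
    by apply: measurable_funM; exact: measurable_pw_comp.
  by apply: (measurableT_comp mK); exact: measurable_fun_pair.
transitivity (\int[leb]_u \int[leb]_l H (l - u)%R u).
  apply: eq_integral => u _.
  by rewrite (@ge0_integral_shift _ (- u)%R (fun s => H s u))//; exact: mH.
rewrite -(fubini_tonelli (m1 := leb) (m2 := leb) (fun p : measurableTypeR R * measurableTypeR R =>
  H (p.1 - p.2) p.2)%R) //=; last first.
  by apply: mH => //; apply: measurable_funB.
apply: eq_integral => l _.
(* For [l <= 0] the numbers [l - u] and [u] are not both positive, so both sides vanish. *)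
have [l0|l0] := ltP 0%R l; last first.
  rewrite [pw _ l]pw_le0E// mul0e integral0_eq// => u _.
  rewrite /H; have [u0|u0] := ltP 0%R u; last by rewrite (pw_le0E b u0) mulr0 mul0e.
  by rewrite pw_le0E ?mul0r ?mul0e//; lra.
transitivity (l%:E * \int[leb]_t H (l - l * t)%R (l * t)%R).
  apply/esym/(@ge0_integral_scale _ l (fun u => H (l - u)%R u) l0) => //.
  by apply: mH => //; exact: measurable_funB.
rewrite -ge0_integralZl//; last 2 first.
- apply: mH; last exact: measurable_funM.
  by apply: measurable_funB => //; exact: measurable_funM.
- by rewrite lee_fin ltW.
have mG : measurable_fun [set: R] (fun t =>
    (pw b t * pw a (1 - t))%:E * K (l - l * t, l * t)%R).
  apply: emeasurable_funM; first by apply/measurable_EFinP; exact: measurable_pw_onem.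
  apply: (measurableT_comp mK); apply: measurable_fun_pair; last exact: measurable_funM.
  by apply: measurable_funB => //; exact: measurable_funM.
rewrite -(ge0_integralZl leb measurableT mG); last 2 first.
- by move=> t _; rewrite mule_ge0// lee_fin mulr_ge0 ?pw_ge0.
- by rewrite lee_fin pw_ge0.
apply: eq_integral => t _; rewrite /H !muleA -!EFinM; congr (_%:E * _).
rewrite -[X in (X - _)%R]mulr1 -mulrBr !pw_scale// (pw_gt0E _ l0).
(* The additional exponent 1 is the Jacobian factor [l] of the scaling. *)
rewrite (_ : a + b - 1 = (a - 1) + (b - 1) + 1)%R; last by lra.
rewrite !powRD ?(gt_eqF l0) ?implybT// powRr1 ?ltW//; ring.
Qed.

Lemma GammaE_ge0 a : 0 <= GammaE a.
Proof.
by apply: integral_ge0 => s _; rewrite lee_fin mulr_ge0 ?pw_ge0 ?expR_ge0.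
Qed.

(** The polar substitution with [K] equal to exp(-(s + u)) = exp(-l): the kernel is free of [t], so
    the double integral splits. Infinite values are allowed, which is why no sign condition on [a]
    and [b] appears. *)
Lemma GammaE_BetaE a b : GammaE a * GammaE b = GammaE (a + b) * BetaE b a.
Proof.
pose K (p : R * R) := (expR (- p.1 - p.2))%:E.
have mK : measurable_fun [set: R * R] K.
  apply/measurable_EFinP; apply: measurableT_comp => //.
  by apply: measurable_funB => //; exact: measurable_funN.
have K0 p : 0 <= K p by rewrite lee_fin expR_ge0.
have G0 c s : 0 <= (pw c s * expR (- s))%:E.
  by rewrite lee_fin mulr_ge0 ?pw_ge0 ?expR_ge0.
have B0 t : 0 <= (pw b t * pw a (1 - t))%:E by rewrite lee_fin mulr_ge0 ?pw_ge0.
have mG := @measurable_pw_expR.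
have mB : measurable_fun [set: R] (fun t => (pw b t * pw a (1 - t))%:E).
  by apply/measurable_EFinP; exact: measurable_pw_onem.
rewrite -(ge0_integralZl leb measurableT (mG b) (fun s _ => G0 b s) (GammaE_ge0 a)).
have BE0 : 0 <= BetaE b a by exact: integral_ge0.
rewrite -(ge0_integralZr leb measurableT (mG (a + b)%R) (fun s _ => G0 _ s) BE0).
transitivity (\int[leb]_u \int[leb]_s ((pw a s * pw b u)%:E * K (s, u))).
  apply: eq_integral => u _; rewrite muleC.
  rewrite -(ge0_integralZl leb measurableT (mG a) (fun s _ => G0 a s) (G0 b u)).
  apply: eq_integral => s _; rewrite /K -!EFinM expRD; congr EFin; ring.
rewrite (integral_pw_polar a b mK K0); apply: eq_integral => l _.
rewrite EFinM -muleA; congr (_ * _).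
have e0 : 0 <= (expR (- l))%:E by rewrite lee_fin expR_ge0.
rewrite -(ge0_integralZl leb measurableT mB (fun s _ => B0 s) e0).
apply: eq_integral => t _; rewrite /K -!EFinM mulrC; congr (expR _ * _)%:E.
by rewrite /=; ring.
Qed.

(** The integrand is unbounded at 0 when [a < 1]. The fundamental theorem of calculus is applied
    with the antiderivative t^a / a on closed intervals increasing to []0, 1]], followed by monotone
    convergence. *)
Lemma BetaE_1 a : (0 < a)%R -> BetaE a 1 = (a^-1)%:E.
Proof.
move=> a0.
transitivity (\int[leb]_(t in `]0%R, 1%R]) (t `^ (a - 1))%:E).
  rewrite -integral_itv_bndo_bndc; last first.
    by apply/measurable_EFinP; apply: measurable_funTS; exact: measurable_powR.
  rewrite [RHS]integral_mkcond; apply: eq_integral => t _; rewrite patchE.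
  case: ifPn => [|/negP]; rewrite inE/= in_itv/=.
    move=> /andP[t0 t1]; rewrite !pw_gt0E ?subr_gt0// subrr powRr0 mulr1//.
  move=> /negP; rewrite negb_and -!leNgt => /orP[t0|t1].
    by rewrite pw_le0E ?mul0r.
  by rewrite [pw 1 _]pw_le0E ?mulr0// subr_le0.
(* With [n.+2] the left end lies strictly below 1 even for [n = 0], so every interval is
   nondegenerate. *)
pose F n : set R := `[(n.+2%:R)^-1%R, 1%R]%classic.
have FE n : \int[leb]_(t in F n) (t `^ (a - 1))%:E =
    (a^-1 - a^-1 * ((n.+2%:R)^-1 `^ a))%:E.
  have lt1 : ((n.+2%:R)^-1 < 1 :> R)%R by rewrite invf_lt1// ltr1n.
  have gt0 : (0 < (n.+2%:R)^-1 :> R)%R by rewrite invr_gt0.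
  rewrite (@continuous_FTC2 _ _ (fun x => a^-1 * x `^ a)%R)//.
  - by rewrite powR1 mulr1 EFinB.
  - apply: continuous_in_subspaceT => x; rewrite inE/= in_itv/= => /andP[x1 _].
    apply: differentiable_continuous; apply/derivable1_diffP.
    by apply: derivable_powR; rewrite in_itv/= andbT (lt_le_trans gt0).
  - have D x : (0 < x)%R -> derivable (fun x => a^-1 * x `^ a)%R x 1.
      move=> x0; apply: derivableM => //.
      by apply: derivable_powR; rewrite in_itv/= andbT.
    have C x : (0 < x)%R -> {for x, continuous (fun x => a^-1 * x `^ a)%R}.
      by move=> x0; apply: differentiable_continuous; apply/derivable1_diffP; exact: D.
    split.
    + by move=> x; rewrite in_itv/= => /andP[x1 _]; apply: D; exact: lt_trans x1.
    + by apply: cvg_at_right_filter; exact: (C _ gt0).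
    + by apply: cvg_at_left_filter; exact: (C _ ltr01).
  - move=> x; rewrite in_itv/= => /andP[x1 _].
    have x0 : (0 < x)%R by exact: lt_trans x1.
    rewrite derive1Ml; last by apply: derivable_powR; rewrite in_itv/= andbT.
    rewrite powR_derive1 ?in_itv/= ?andbT//.
    by rewrite mulrA mulVf ?gt_eqF// mul1r.
have U : `]0%R, 1%R]%classic = \bigcup_n F n.
  apply/seteqP; split => [x|x [n _]]; rewrite /F/= !in_itv/=; last first.
    by move=> /andP[x0 ->]; rewrite (lt_le_trans _ x0)// invr_gt0.
  move=> /andP[x0 x1]; near \oo => n; exists n => //.
  rewrite /F/= in_itv/= x1 andbT.
  rewrite -[leRHS]invrK lef_pV2 ?posrE ?invr_gt0//.
  have xn : (x^-1 <= n%:R)%R by near: n; exact: nbhs_infty_ger.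
  by apply: (le_trans xn); rewrite ler_nat -addn2 leq_addr.
have cvg1 : \int[leb]_(t in F n) (t `^ (a - 1))%:E @[n --> \oo] -->
   \int[leb]_(t in `]0%R, 1%R]) (t `^ (a - 1))%:E.
  rewrite U; apply: ge0_nondecreasing_set_cvg_integral.
  - move=> n m nm; apply/subsetPset => x; rewrite /F/= !in_itv/= => /andP[nx ->].
    rewrite andbT (le_trans _ nx)// lef_pV2 ?posrE// ler_nat.
    by rewrite !ltnS.
  - by move=> n; exact: measurable_itv.
  - by move=> n; apply/measurable_EFinP; apply: measurable_funTS; exact: measurable_powR.
  - by move=> n x _; rewrite lee_fin powR_ge0.
apply: (cvg_unique _ cvg1) => //.
rewrite (_ : (fun n => _) = (fun n => (a^-1 - a^-1 * ((n.+2%:R)^-1 `^ a))%:E)); last first.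
  by apply/funext => n; exact: FE.
apply: cvg_EFin; first exact: nearW.
rewrite -[X in _ --> X]subr0; apply: cvgB; first exact: cvg_cst.
rewrite -[X in _ --> X](mulr0 a^-1%R); apply: cvgM; first exact: cvg_cst.
have := powR_cvg0 a0; move/cvg_at_rightP; apply; split.
  by move=> n; rewrite invr_gt0.
rewrite (_ : (fun n => _) = (fun n => [sequence (n.+1%:R : R)^-1%R]_n (n + 1)%N)); last first.
  by apply/funext => n /=; rewrite addn1.
by rewrite cvg_shiftn; exact: cvg_harmonic.
Unshelve. all: by end_near. Qed.

End gamma.

(** * Positivity and finiteness of Gamma and Beta, and the negative binomial series *)

Section gamma2.
Local Open Scope ereal_scope.
Local Opaque Gammaf Betaf.
Variable R : realType.
Local Notation leb := (@lebesgue_measure R).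

(** A zero integral would make [f] vanish off a null set, and that null set would contain an
    interval of length 1. *)
Lemma integral_gt0 (f : R -> \bar R) : measurable_fun [set: R] f ->
  (forall t, 0 <= f t) -> (forall t, (0 < t < 1)%R -> 0 < f t) ->
  0 < \int[leb]_t f t.
Proof.
move=> mf f0 fp; rewrite lt_def integral_ge0// andbT; apply/eqP => I0.
have : \int[leb]_t `|f t| = 0.
  by rewrite -I0; apply: eq_integral => t _; rewrite gee0_abs.
move/(ae_eq_integral_abs leb measurableT mf).1 => [N [mN N0 fN]].
suff : leb (`]0%R, 1%R[%classic : set R) <= leb N.
  by rewrite N0 lebesgue_measure_itv/= lte_fin ltr01 oppr0 adde0 lee_fin ler10.
apply: le_measure; rewrite ?inE//.
move=> t /=; rewrite in_itv/= => t01; apply: fN => /= /(_ I) ft0.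
by have := fp _ t01; rewrite ft0 ltxx.
Qed.

Lemma GammaE_gt0 (a : R) : 0 < GammaE a.
Proof.
apply: integral_gt0; first exact: measurable_pw_expR.
  by move=> s; rewrite lee_fin mulr_ge0 ?pw_ge0 ?expR_ge0.
by move=> s /andP[s0 _]; rewrite lte_fin pw_gt0E// mulr_gt0 ?powR_gt0 ?expR_gt0.
Qed.

(** The integrand is the exponential density of rate 1 except at the origin, where [pw] is 0 and the
    density is 1; that point is removed from both integrals. *)
Lemma GammaE1 : GammaE (1 : R) = 1.
Proof.
have D1 (f : R -> \bar R) : measurable_fun [set: R] f ->
    \int[leb]_(x in [set: R] `\ 0%R) f x = \int[leb]_x f x.
  move=> mf; apply: integral_setD1; first exact: measurableD.
  by apply: measurable_funS mf.
rewrite -[RHS](@integral_exponential_pdf R 1)// /GammaE.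
rewrite -[LHS]D1; last exact: measurable_pw_expR.
rewrite -[RHS]D1; last by apply/measurable_EFinP; exact: measurable_exponential_pdf.
apply: eq_integral => s; rewrite inE/= => -[_ /eqP s0].
have [sp|sn] := ltP 0%R s; last first.
  by rewrite pw_le0E// mul0r lt0_exponential_pdf// lt_neqAle s0 sn.
by rewrite pw_gt0E// subrr powRr0 mul1r exponential_pdfE ?ltW// mul1r mulN1r.
Qed.

(** Taking one argument equal to 1 in the Gamma-Beta relation replaces integration by parts and
    presupposes no finiteness. *)
Lemma GammaE_addl1 (a : R) : (0 < a)%R -> GammaE (1 + a)%R = a%:E * GammaE a.
Proof.
move=> a0; have := GammaE_BetaE 1 a.
rewrite GammaE1 mul1e BetaE_1// => ->.
by rewrite muleCA -EFinM mulfV ?gt_eqF// mule1.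
Qed.

(** The functional equation gives finiteness at the positive integers. In general the integrand is
    at most s^(a-1) on []0, 1[], with integral 1/a, and for s >= 1 at most the integrand of Gamma(1
    + n), where n >= a. *)
Lemma GammaE_lty (a : R) : (0 < a)%R -> GammaE a < +oo.
Proof.
move=> a0.
have nat_lty n : GammaE (1 + n%:R : R)%R < +oo.
  elim: n => [|n IH]; first by rewrite addr0 GammaE1 ltry.
  rewrite GammaE_addl1// -natr1 addrC lte_mul_pinfty ?lee_fin ?addr_ge0//.
pose n := Num.bound a.
have an : (a <= n%:R)%R by rewrite ltW// archi_boundP// ltW.
have mP : measurable_fun [set: R] (fun t => (pw a t * pw 1 (1 - t))%:E).
  by apply/measurable_EFinP; exact: measurable_pw_onem.
(* The factor [pw 1 (1 - s)] is the indicator of [s < 1]. *)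
apply: (@le_lt_trans _ _ (\int[leb]_s
    ((pw a s * pw 1 (1 - s))%:E + (pw (1 + n%:R) s * expR (- s))%:E))).
  apply: ge0_le_integral => //.
  - by move=> s _; rewrite lee_fin mulr_ge0 ?pw_ge0 ?expR_ge0.
  - exact: measurable_pw_expR.
  - by apply: emeasurable_funD => //; exact: measurable_pw_expR.
  move=> s _; rewrite -EFinD lee_fin.
  have [s0|s0] := ltP 0%R s; last by rewrite !(pw_le0E _ s0) !mul0r addr0.
  have [s1|s1] := ltP s 1%R.
    rewrite [pw 1 _]pw_gt0E ?subr_gt0// subrr powRr0 mulr1.
    rewrite (@le_trans _ _ (pw a s))//.
      by rewrite ler_piMr ?pw_ge0// -expR0 ler_expR; lra.
    by rewrite lerDl mulr_ge0 ?pw_ge0 ?expR_ge0.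
  rewrite [pw 1 _]pw_le0E ?subr_le0// mulr0 add0r ler_wpM2r ?expR_ge0//.
  by rewrite !pw_gt0E// ler_powR//; lra.
rewrite ge0_integralD//; last 3 first.
- by move=> s _; rewrite lee_fin mulr_ge0 ?pw_ge0.
- by move=> s _; rewrite lee_fin mulr_ge0 ?pw_ge0 ?expR_ge0.
- exact: measurable_pw_expR.
by rewrite -/(BetaE a 1) BetaE_1// lte_add_pinfty ?ltry//; exact: nat_lty.
Qed.

Lemma GammafK (a : R) : (0 < a)%R -> GammaE a = (Gammaf a)%:E.
Proof. by move=> a0; rewrite GammafE fineK// ge0_fin_numE ?GammaE_ge0 ?GammaE_lty. Qed.

Lemma Gammaf_gt0 (a : R) : (0 < a)%R -> (0 < Gammaf a)%R.
Proof. by move=> a0; rewrite -lte_fin -GammafK// GammaE_gt0. Qed.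

Lemma Gammaf_pochhammer (a : R) n : (0 < a)%R ->
  (Gammaf (a + n%:R) = pochhammer a n * Gammaf a)%R.
Proof.
move=> a0; elim: n => [|n IH]; first by rewrite addr0 /pochhammer big_ord0 mul1r.
have an0 : (0 < a + n%:R)%R by rewrite ltr_wpDr.
rewrite /pochhammer big_ord_recr/= -/(pochhammer a n) mulrAC -IH.
have := GammaE_addl1 an0; rewrite (GammafK an0) (GammafK (addr_gt0 ltr01 an0)) -EFinM => -[E].
rewrite mulrC -E -natr1; congr Gammaf; ring.
Qed.

(** An infinite Beta integral, multiplied by the positive value at [b + a], would make the product
    of two finite Gamma values infinite. *)
Lemma BetafK (a b : R) : (0 < a)%R -> (0 < b)%R -> BetaE a b = (Betaf a b)%:E.
Proof.
move=> a0 b0; rewrite BetafE fineK//.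
have ba0 : (0 < b + a)%R by rewrite addr_gt0.
have B0 : 0 <= BetaE a b.
  by apply: integral_ge0 => t _; rewrite lee_fin mulr_ge0 ?pw_ge0.
rewrite ge0_fin_numE// ltNge leye_eq; apply/negP => /eqP B.
have := GammaE_BetaE b a; rewrite B !GammafK// gt0_muley ?lte_fin ?Gammaf_gt0//.
Qed.

Lemma Betaf_Gammaf (a b : R) : (0 < a)%R -> (0 < b)%R ->
  Betaf a b = (Gammaf a * Gammaf b / Gammaf (a + b))%R.
Proof.
move=> a0 b0; have ba0 : (0 < b + a)%R by rewrite addr_gt0.
have := GammaE_BetaE b a; rewrite BetafK// !GammafK// -!EFinM => -[E].
apply: (mulfI (lt0r_neq0 (Gammaf_gt0 ba0))).
rewrite [in RHS](addrC a) mulrCA mulfV ?lt0r_neq0 ?Gammaf_gt0// mulr1.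
by rewrite -E mulrC.
Qed.

Lemma expR_nneseries (x : R) : (0 <= x)%R ->
  (expR x)%:E = \sum_(n <oo) (x ^+ n / n`!%:R)%:E.
Proof.
move=> x0; rewrite /expR -EFin_lim; last exact: is_cvg_series_exp_coeff.
congr (limn _); apply/funext => n /=.
by rewrite -sumEFin.
Qed.

(* Negative binomial series, obtained by expanding [expR (v l)] under the
   Gamma integral. *)
Lemma Gamma_series (p c v : R) : (0 < p)%R -> (0 <= v < c)%R ->
  \sum_(n <oo) (v ^+ n / n`!%:R * c `^ (- (p + n%:R)) * Gammaf (p + n%:R))%:E =
  ((c - v) `^ (- p) * Gammaf p)%:E.
Proof.
move=> p0 /andP[v0 vc]; have c0 : (0 < c)%R by lra.
rewrite EFinM -GammafK// -integral_pw_expR ?subr_gt0//.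
(* The power [l ^+ n] from the exponential series is absorbed into the weight, which turns [pw p]
   into [pw (p + n%:R)]. *)
pose f n l := (v ^+ n / n`!%:R)%:E * (pw (p + n%:R) l * expR (- (c * l)))%:E.
have vn n : (0 <= v ^+ n / n`!%:R)%R by rewrite mulr_ge0 ?exprn_ge0.
have mf0 n : measurable_fun [set: R] (fun l => (pw (p + n%:R) l * expR (- (c * l)))%:E).
  apply/measurable_EFinP; apply: measurable_funM; first exact: measurable_pw.
  by apply: measurableT_comp => //; apply: measurable_funN; exact: measurable_funM.
have f0 n l : 0 <= (pw (p + n%:R) l * expR (- (c * l)))%:E.
  by rewrite lee_fin mulr_ge0 ?pw_ge0 ?expR_ge0.
transitivity (\int[leb]_l \sum_(n <oo) f n l).
  rewrite integral_nneseries//; last 2 first.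
  - by move=> n; apply: emeasurable_funM; [exact: measurable_cst|exact: mf0].
  - by move=> n l _; apply: mule_ge0; [rewrite lee_fin; exact: vn|exact: f0].
  apply: eq_eseriesr => n _; rewrite /f (ge0_integralZl leb measurableT (mf0 n))//; last first.
    by rewrite lee_fin; exact: vn.
  have pn0 : (0 < p + n%:R)%R by rewrite ltr_wpDr.
  by rewrite integral_pw_expR// GammafK// -!EFinM mulrA.
apply: eq_integral => l _.
have [l0|l0] := ltP 0%R l; last first.
  rewrite [pw p l]pw_le0E// mul0r eseries0// => n _ _.
  by rewrite /f [pw _ l]pw_le0E// mul0r mule0.
transitivity ((pw p l * expR (- (c * l)))%:E * (expR (v * l))%:E).
  have vl0 : (0 <= v * l)%R by apply: mulr_ge0 => //; exact: ltW.
  rewrite (expR_nneseries vl0).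
  transitivity (\sum_(n <oo) ((pw p l * expR (- (c * l)))%:E *
      ((v * l) ^+ n / n`!%:R)%:E)); last first.
    apply: nneseriesZl => n _.
    by rewrite lee_fin mulr_ge0// exprn_ge0.
  apply: eq_eseriesr => n _; rewrite /f -!EFinM -pwX exprMn; congr EFin; ring.
rewrite -EFinM -mulrA -expRD; congr (_ * expR _)%:E; ring.
Qed.

End gamma2.

(** * Borel sets and integration on R^d *)

Section Rd.
Local Open Scope ereal_scope.
Variable R : realType.
Local Notation leb := (@lebesgue_measure R).
(** Carries the sigma-algebra of [borel_Rd], so that the Borel sets of the theorem are the
    measurable sets of this type. *)
Definition Rd (d : nat) := g_sigma_algebraType (@open 'rV[R]_d).

Lemma measurable_coord d (i : 'I_d) :
  measurable_fun [set: Rd d] (fun v : Rd d => (v : 'rV[R]_d) 0%R i).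
Proof.
apply: (measurability _ (RGenOpens.measurableE R)) => _ [_ [a [b ->]] <-].
rewrite setTI; apply: sub_sigma_algebra.
apply: open_comp; last exact: interval_open.
by move=> x _; exact: coord_continuous.
Qed.

(** An open set is the union of the boxes with rational ends that it contains; there are countably
    many, and the preimage of each is a finite intersection of coordinate preimages. This reduces
    measurability into R^d to real-valued functions. *)
Lemma measurable_coordP d0 (T : measurableType d0) d (f : T -> Rd d) :
  (forall i, measurable_fun [set: T] (fun t => (f t : 'rV[R]_d) 0%R i)) ->
  measurable_fun [set: T] f.
Proof.
move=> mf; apply: (@measurability _ _ T (Rd d) setT f (@open 'rV[R]_d)) => //.
move=> _ [U oU <-]; rewrite setTI.
pose box (q : {ffun 'I_d -> rat * rat}) : set 'rV[R]_d :=
  [set v : 'rV[R]_d | forall i, (ratr (q i).1 < v 0%R i < ratr (q i).2)%R].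
(* The union runs over all rational boxes, a countable index type; those not inside [U] contribute
   the empty set. *)
have -> : f @^-1` U = \bigcup_q (if `[< box q `<=` U >] then f @^-1` box q else set0).
  apply/seteqP; split => [t Ut|t [q _]]; last first.
    by case: asboolP => // qU; exact: qU.
  have : nbhs (f t : 'rV[R]_d) U by exact: open_nbhs_nbhs.
  rewrite -nbhs_ballE => -[e /= e0 eU].
  have /choice[q1 q1P] : forall i, exists q : rat,
      ((f t : 'rV[R]_d) 0 i - e < ratr q < (f t : 'rV[R]_d) 0 i)%R.
    move=> i; have [|q] := @rat_in_itvoo R ((f t : 'rV[R]_d) 0 i - e)%R ((f t : 'rV[R]_d) 0 i)%R.
      by rewrite ltrBlDr ltrDl.
    by rewrite in_itv/=; exists q.
  have /choice[q2 q2P] : forall i, exists q : rat,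
      ((f t : 'rV[R]_d) 0 i < ratr q < (f t : 'rV[R]_d) 0 i + e)%R.
    move=> i; have [|q] := @rat_in_itvoo R ((f t : 'rV[R]_d) 0 i)%R ((f t : 'rV[R]_d) 0 i + e)%R.
      by rewrite ltrDl.
    by rewrite in_itv/=; exists q.
  exists [ffun i => (q1 i, q2 i)] => //.
  case: asboolP => [_ i|]; first by rewrite ffunE/=; have := q1P i; have := q2P i; lra.
  case=> v bv; apply: eU; split => // i j.
  rewrite ord1 /ball/= ltr_distl.
  have := bv j; rewrite ffunE/=; have := q1P j; have := q2P j; lra.
apply: countable_bigcupT_measurable; first exact: countableP.
move=> q; case: ifP => // _.
rewrite (_ : f @^-1` box q = \bigcap_(i in [set: 'I_d])
  ((fun t => (f t : 'rV[R]_d) 0%R i) @^-1` `](ratr (q i).1)%R, (ratr (q i).2)%R[)).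
  apply: fin_bigcap_measurable => // i _; rewrite -[X in measurable X]setTI.
  exact: mf.
apply/seteqP; split => [t tq i _|t tq i] /=; first by rewrite in_itv/=; exact: tq.
by have := tq i I; rewrite /= in_itv.
Qed.

End Rd.

(** * Tonelli, translation and Gaussian convolution for the iterated integral *)

Section Rd2.
Local Open Scope ereal_scope.
Variable R : realType.
Local Notation leb := (@lebesgue_measure R).
Local Notation Rd := (Rd R).

Lemma measurable_RdD d0 (T : measurableType d0) d (f g : T -> Rd d) :
  measurable_fun [set: T] f -> measurable_fun [set: T] g ->
  measurable_fun [set: T] (fun t => (f t + g t)%R : Rd d).
Proof.
move=> mf mg; apply: measurable_coordP => i.
apply: (eq_measurable_fun (fun t => (f t) 0%R i + (g t) 0%R i)%R).
  by move=> t _; rewrite mxE.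
by apply: measurable_funD; [exact: measurableT_comp (measurable_coord _) mf
  |exact: measurableT_comp (measurable_coord _) mg].
Qed.

Lemma measurable_RdB d0 (T : measurableType d0) d (f g : T -> Rd d) :
  measurable_fun [set: T] f -> measurable_fun [set: T] g ->
  measurable_fun [set: T] (fun t => (f t - g t)%R : Rd d).
Proof.
move=> mf mg; apply: measurable_coordP => i.
apply: (eq_measurable_fun (fun t => (f t) 0%R i - (g t) 0%R i)%R).
  by move=> t _; rewrite !mxE.
by apply: measurable_funB; [exact: measurableT_comp (measurable_coord _) mf
  |exact: measurableT_comp (measurable_coord _) mg].
Qed.

Lemma measurable_sqnorm d : measurable_fun [set: Rd d] (fun v : Rd d => sqnorm v).
Proof.
apply: measurable_sum => i; apply: measurable_funX; exact: measurable_coord.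
Qed.

Lemma measurable_row_mx d0 (T : measurableType d0) d (f : T -> R) (g : T -> Rd d) :
  measurable_fun [set: T] f -> measurable_fun [set: T] g ->
  measurable_fun [set: T] (fun t => row_mx (const_mx (f t) : 'rV[R]_1) (g t) : Rd d.+1).
Proof.
move=> mf mg; apply: measurable_coordP => i.
case: (split_ordP (i : 'I_(1 + d))) => j ->.
  apply: (eq_measurable_fun f) => // t _; apply/esym.
  by rewrite (row_mxEl (const_mx (f t) : 'rV[R]_1) (g t)) mxE.
apply: (eq_measurable_fun (fun t => (g t) 0%R j)).
  by move=> t _; apply/esym/row_mxEr.
exact: measurableT_comp (measurable_coord _) mg.
Qed.

Lemma integral_Rd_ge0 d (f : Rd d -> \bar R) :
  (forall v, 0 <= f v) -> 0 <= integral_Rd f.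
Proof.
elim: d f => [|d IH] f f0 //=.
by apply: integral_ge0 => x _; exact: IH.
Qed.

(** The parameter space is arbitrary because the induction enlarges it: the first coordinate of the
    vector joins [T], and the hypothesis is used on [T * R] in dimension one less. *)
Lemma measurable_integral_Rd d0 (T : measurableType d0) d (f : T * Rd d -> \bar R) :
  measurable_fun [set: T * Rd d] f -> (forall p, 0 <= f p) ->
  measurable_fun [set: T] (fun t => integral_Rd (fun v => f (t, v))).
Proof.
elim: d d0 T f => [|d IH] d0 T f mf f0 /=.
  by apply: (measurableT_comp mf); exact: measurable_fun_pair.
apply: (@measurable_fun_fubini_tonelli_F _ _ _ _ _ leb (fun p : T * measurableTypeR R =>
  integral_Rd (fun v => f (p.1, row_mx (const_mx p.2 : 'rV[R]_1) v)))) => //=.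
  apply: (IH _ _ (fun q : (T * measurableTypeR R) * Rd d =>
     f (q.1.1, row_mx (const_mx q.1.2 : 'rV[R]_1) q.2))) => //.
  apply: (measurableT_comp mf); apply: measurable_fun_pair.
    exact: measurableT_comp.
  apply: measurable_row_mx => //; exact: measurableT_comp.
by move=> p; exact: integral_Rd_ge0.
Qed.

(** The measure [m] is left general so that the lemma serves both the mixing variables, under
    Lebesgue measure, and the law of a random vector. *)
Lemma integral_Rd_tonelli d0 (T : measurableType d0)
    (m : {sigma_finite_measure set T -> \bar R}) d (f : T * Rd d -> \bar R) :
  measurable_fun [set: T * Rd d] f -> (forall p, 0 <= f p) ->
  \int[m]_t integral_Rd (fun v => f (t, v)) =
  integral_Rd (fun v => \int[m]_t f (t, v)).
Proof.
elim: d f => [|d IH] f mf f0 //=.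
have mc : measurable_fun setT (fun q : (T * measurableTypeR R) * Rd d =>
     f (q.1.1, row_mx (const_mx q.1.2 : 'rV[R]_1) q.2)).
  apply: (measurableT_comp mf); apply: measurable_fun_pair.
    exact: measurableT_comp.
  apply: measurable_row_mx => //; exact: measurableT_comp.
rewrite (fubini_tonelli (m1 := m) (m2 := leb) (fun p : T * measurableTypeR R =>
  integral_Rd (fun v => f (p.1, row_mx (const_mx p.2 : 'rV[R]_1) v)))) /=; last 2 first.
- exact: (measurable_integral_Rd mc).
- by move=> p; exact: integral_Rd_ge0.
apply: eq_integral => x _.
apply: (IH (fun p => f (p.1, row_mx (const_mx x : 'rV[R]_1) p.2))) => //.
apply: (measurableT_comp mf); apply: measurable_fun_pair => //.
by apply: measurable_row_mx.
Qed.

Lemma integral_Rd_exchange d e (f : Rd d * Rd e -> \bar R) :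
  measurable_fun setT f -> (forall p, 0 <= f p) ->
  integral_Rd (fun v => integral_Rd (fun w => f (v, w))) =
  integral_Rd (fun w => integral_Rd (fun v => f (v, w))).
Proof.
elim: d f => [|d IH] f mf f0 //=.
rewrite -(@integral_Rd_tonelli _ _ leb e (fun p : measurableTypeR R * Rd e =>
  integral_Rd (fun v => f (row_mx (const_mx p.1 : 'rV[R]_1) v, p.2)))) /=; last 2 first.
- apply: (@measurable_integral_Rd _ _ d (fun q : (measurableTypeR R * Rd e) * Rd d =>
    f (row_mx (const_mx q.1.1 : 'rV[R]_1) q.2, q.1.2))) => //.
  apply: (measurableT_comp mf); apply: measurable_fun_pair.
    by apply: measurable_row_mx => //; exact: measurableT_comp.
  exact: measurableT_comp.
- by move=> p; exact: integral_Rd_ge0.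
apply: eq_integral => x _.
apply: (IH (fun q => f (row_mx (const_mx x : 'rV[R]_1) q.1, q.2))) => //.
apply: (measurableT_comp mf); apply: measurable_fun_pair => //.
by apply: measurable_row_mx.
Qed.

Lemma integral_RdZl d (c : R) (f : Rd d -> \bar R) : (0 <= c)%R ->
  measurable_fun setT f -> (forall v, 0 <= f v) ->
  integral_Rd (fun v => c%:E * f v) = c%:E * integral_Rd f.
Proof.
move=> c0; elim: d f => [|d IH] f mf f0 //=.
rewrite -ge0_integralZl//; last 2 first.
- apply: (@measurable_integral_Rd _ (measurableTypeR R) d (fun q =>
    f (row_mx (const_mx q.1 : 'rV[R]_1) q.2))) => //.
  by apply: (measurableT_comp mf); exact: measurable_row_mx.
- by move=> x _; exact: integral_Rd_ge0.
apply: eq_integral => x _; apply: IH => //.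
by apply: (measurableT_comp mf); exact: measurable_row_mx.
Qed.

Lemma row_mx_addr d (x : R) (v : 'rV[R]_d) (a : 'rV[R]_(1 + d)) :
  (row_mx (const_mx x : 'rV[R]_1) v + a =
   row_mx (const_mx (x + a 0 0) : 'rV[R]_1) (v + rsubmx a))%R.
Proof.
rewrite -[in LHS](hsubmxK a) add_row_mx.
congr row_mx; apply/matrixP => i j; rewrite !mxE; congr (_ + a _ _)%R.
  by rewrite ord1.
by apply/val_inj; rewrite /= ord1.
Qed.

Lemma integral_Rd_shift d (a : 'rV[R]_d) (f : Rd d -> \bar R) :
  measurable_fun setT f -> (forall v, 0 <= f v) ->
  integral_Rd (fun v => f (v + a)%R) = integral_Rd f.
Proof.
elim: d a f => [|d IH] a f mf f0 /=; first by rewrite add0r [a]thinmx0.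
rewrite -[RHS](ge0_integral_shift (a 0 0)%R); last 2 first.
- apply: (@measurable_integral_Rd _ (measurableTypeR R) d (fun q =>
    f (row_mx (const_mx q.1 : 'rV[R]_1) q.2))) => //.
  by apply: (measurableT_comp mf); exact: measurable_row_mx.
- by move=> x; exact: integral_Rd_ge0.
apply: eq_integral => x _ /=.
rewrite -[RHS](IH (rsubmx (a : 'rV_(1 + d)))) //; last first.
  by apply: (measurableT_comp mf); exact: measurable_row_mx.
congr integral_Rd; apply/funext => v; congr f; exact: row_mx_addr.
Qed.

Lemma sqnorm_row_mx d (x : R) (v : 'rV[R]_d) :
  @sqnorm R d.+1 (row_mx (const_mx x : 'rV[R]_1) v) = (x ^+ 2 + sqnorm v)%R.
Proof.
rewrite -[LHS]/(@sqnorm R (1 + d) (row_mx (const_mx x : 'rV[R]_1) v)).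
rewrite /sqnorm big_split_ord /= big_ord1 row_mxEl mxE.
by congr (_ + _)%R; apply: eq_bigr => i _; rewrite row_mxEr.
Qed.

Lemma sqnorm_row_mxB d (x y : R) (v w : 'rV[R]_d) :
  @sqnorm R d.+1 (row_mx (const_mx x : 'rV[R]_1) v - row_mx (const_mx y : 'rV[R]_1) w) =
  ((x - y) ^+ 2 + sqnorm (v - w))%R.
Proof.
rewrite -sqnorm_row_mx; apply: (congr1 (@sqnorm R (1 + d))).
rewrite opp_row_mx add_row_mx [X in row_mx X _](_ : _ = const_mx (x - y)%R)//.
by apply/matrixP => i j; rewrite !mxE.
Qed.

(** Completing the square: u y^2 + s (z - y)^2 = (s + u) (y - b)^2 + (s u / (s + u)) z^2 with b = s
    z / (s + u). A shift and a scaling then reduce to the standard Gaussian integral. *)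
Lemma integral_gauss (s u z : R) : (0 < s)%R -> (0 < u)%R ->
  \int[leb]_y (expR (- (u * y ^+ 2) - s * (z - y) ^+ 2))%:E =
  (Num.sqrt (pi / (s + u)) * expR (- (s * u / (s + u) * z ^+ 2)))%:E.
Proof.
move=> s0 u0; have su0 : (0 < s + u)%R by lra.
have c0 : (0 < Num.sqrt (s + u))%R by rewrite sqrtr_gt0.
pose b := (s * z / (s + u))%R.
have E y : (expR (- (u * y ^+ 2) - s * (z - y) ^+ 2) =
   expR (- (s * u / (s + u) * z ^+ 2)) * gauss_fun (Num.sqrt (s + u) * (y + - b)))%R.
  rewrite /gauss_fun -expRD; congr expR.
  rewrite [in RHS]exprMn sqr_sqrtr 1?ltW// /b; field; lra.
under eq_integral do rewrite E EFinM.
have mg : measurable_fun [set: R] (fun y => (gauss_fun y)%:E).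
  by apply/measurable_EFinP; exact: measurable_gauss_fun.
have mg2 : measurable_fun [set: R] (fun y => (gauss_fun (Num.sqrt (s + u) * y))%:E).
  apply/measurable_EFinP; apply: measurableT_comp; first exact: measurable_gauss_fun.
  exact: measurable_funM.
rewrite ge0_integralZl//; last 2 first.
- apply/measurable_EFinP; apply: measurableT_comp; first exact: measurable_gauss_fun.
  by apply: measurable_funM => //; exact: measurable_funD.
- by move=> y _; rewrite lee_fin gauss_fun_ge0.
rewrite (ge0_integral_shift (- b)%R mg2); last by move=> y; rewrite lee_fin gauss_fun_ge0.
have := ge0_integral_scale c0 mg (fun y => gauss_fun_ge0 y).
rewrite integralT_gauss => H.
have -> : \int[leb]_x (gauss_fun (Num.sqrt (s + u) * x))%:E =
    ((Num.sqrt (s + u))^-1 * Num.sqrt pi)%:E.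
  by rewrite EFinM -H muleA -EFinM mulVf ?gt_eqF// mul1e.
rewrite -EFinM sqrtrM ?pi_ge0// sqrtrV ?ltW//; congr EFin; ring.
Qed.

(** The integrand is a product over coordinates, so each dimension contributes one factor of the
    one-dimensional formula. *)
Lemma integral_Rd_gauss d (s u : R) (z : 'rV[R]_d) : (0 < s)%R -> (0 < u)%R ->
  integral_Rd (fun y => (expR (- (u * sqnorm y) - s * sqnorm (z - y)))%:E) =
  (Num.sqrt (pi / (s + u)) ^+ d * expR (- (s * u / (s + u) * sqnorm z)))%:E.
Proof.
move=> s0 u0; elim: d z => [|d IH] z /=.
  by rewrite /sqnorm !big_ord0 !mulr0 subr0 expr0 mul1r.
rewrite -[z](hsubmxK (z : 'rV_(1 + d))).
set z0 := lsubmx _; set z' := rsubmx _.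
rewrite [z0](_ : _ = const_mx (z0 0 0)%R); last first.
  by apply/matrixP => i j; rewrite !ord1 [RHS]mxE.
move: (z0 0 0)%R => {z0}x.
under eq_integral => y _.
  under eq_fun => v.
    rewrite (sqnorm_row_mx y v) (sqnorm_row_mxB x y z' v).
    rewrite [X in expR X](_ : _ = (- (u * y ^+ 2) - s * (x - y) ^+ 2)
      + (- (u * sqnorm v) - s * sqnorm (z' - v)))%R; last by ring.
    rewrite expRD EFinM; over.
  rewrite integral_RdZl ?expR_ge0//; last first.
    apply/measurable_EFinP; apply: measurableT_comp => //.
    apply: measurable_funB.
      apply: measurable_funN; apply: measurable_funM => //.
      exact: measurable_sqnorm.
    apply: measurable_funM => //.
    by apply: (measurableT_comp (@measurable_sqnorm _)); exact: measurable_RdB.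
  rewrite IH muleC; over.
rewrite ge0_integralZl//; last first.
  apply/measurable_EFinP; apply: measurableT_comp => //.
  apply: measurable_funB.
    by apply: measurable_funN; apply: measurable_funM => //; exact: measurable_funX.
  by apply: measurable_funM => //; apply: measurable_funX; exact: measurable_funB.
rewrite integral_gauss// -EFinM; congr EFin.
rewrite (sqnorm_row_mx x z') mulrDr opprD expRD (exprS _ d).
ring.
Qed.

End Rd2.

(** * Law of a sum of independent vectors *)

Section law.
Local Open Scope ereal_scope.
Variable R : realType.
Local Notation Rd := (Rd R).

(** [has_density_Rd] evaluates probabilities of sets, not expectations of functions. The double
    integral is therefore arranged so that each density is applied only to a section of the set of
    pairs whose sum lies in [A]: that of [Y] with the first entry fixed, that of [X] with the second
    fixed after Tonelli. *)
Lemma has_density_RdD d0 (Omega : measurableType d0) (P : probability Omega R)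
    d (X Y : Omega -> 'rV[R]_d) (f g h : 'rV[R]_d -> R) :
  measurable_fun [set: Rd d] (f : Rd d -> R) -> (forall x, 0 <= f x)%R ->
  measurable_fun [set: Rd d] (g : Rd d -> R) -> (forall x, 0 <= g x)%R ->
  has_density_Rd P X f -> has_density_Rd P Y g -> independent_Rd P X Y ->
  (forall z, (h z)%:E = integral_Rd (fun y => (g y * f (z - y))%:E)) ->
  has_density_Rd P (fun w => X w + Y w)%R h.
Proof.
move=> mf f0 mg g0 [bX dX] [bY dY] indep hE.
have mX : measurable_fun [set: Omega] (X : Omega -> Rd d).
  by move=> _ A mA; rewrite setTI; exact: bX.
have mY : measurable_fun [set: Omega] (Y : Omega -> Rd d).
  by move=> _ A mA; rewrite setTI; exact: bY.
have mXY : measurable_fun [set: Omega] (fun w => (X w, Y w) : Rd d * Rd d).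
  exact: measurable_fun_pair.
have mD := measurable_RdD mX mY.
split=> A mA; first by rewrite -[_ @^-1` _]setTI; exact: mD.
pose X' : {mfun Omega >-> Rd d} := HB.pack (X : Omega -> Rd d) (isMeasurableFun.Build _ _ _ _ _ mX).
pose Y' : {mfun Omega >-> Rd d} := HB.pack (Y : Omega -> Rd d) (isMeasurableFun.Build _ _ _ _ _ mY).
pose XY' : {mfun Omega >-> (Rd d * Rd d)%type} :=
  HB.pack (fun w => (X w, Y w) : Rd d * Rd d) (isMeasurableFun.Build _ _ _ _ _ mXY).
pose PX := distribution P X'; pose PY := distribution P Y'; pose PXY := distribution P XY'.
pose S : set (Rd d * Rd d) := (fun p => (p.1 + p.2)%R : Rd d) @^-1` A.
have madd : measurable_fun [set: Rd d * Rd d] (fun p => (p.1 + p.2)%R : Rd d).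
  by apply: measurable_RdD.
have mS : measurable S by rewrite -[S]setTI; exact: madd.
have m1S : measurable_fun [set: Rd d * Rd d] (\1_S : _ -> R) by exact: measurable_indic.
(* Independence makes the joint law agree with the product of the laws on rectangles, which
   determines it. *)
transitivity ((PX \x PY) S).
  by rewrite (@product_measure_unique _ _ _ _ _ PX PY PXY).
transitivity (\int[PX]_x integral_Rd (fun y => (\1_S (x, y) * g y)%:E)).
  apply: eq_integral => x _ /=.
  have mSx : measurable (xsection S x) by exact: measurable_xsection.
  rewrite [LHS](dY _ mSx); congr integral_Rd; apply/funext => y.
  by rewrite !indicE mem_xsection.
rewrite (@integral_Rd_tonelli _ _ _ PX d (fun p => (\1_S p * g p.2)%:E)); last 2 first.
- apply/measurable_EFinP; apply: measurable_funM => //.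
  exact: measurableT_comp.
- by move=> p; rewrite lee_fin mulr_ge0.
pose F (p : Rd d * Rd d) : \bar R := (g p.2 * (\1_A p.1 * f (p.1 - p.2)))%:E.
have mF : measurable_fun setT F.
  apply/measurable_EFinP; apply: measurable_funM; first exact: measurableT_comp.
  apply: measurable_funM.
    by apply: (measurableT_comp (f := \1_A : Rd d -> R)) => //; exact: measurable_indic.
  by apply: (measurableT_comp mf); exact: measurable_RdB.
have F0 p : 0 <= F p by rewrite lee_fin !mulr_ge0.
transitivity (integral_Rd (fun y => integral_Rd (fun z => F (z, y)))).
  congr integral_Rd; apply/funext => y.
  transitivity ((g y)%:E * PX (ysection S y)).
    have mSy : measurable (ysection S y) by exact: measurable_ysection.
    have mI : measurable_fun [set: Rd d] (fun x => (\1_(ysection S y) x)%:E : \bar R).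
      by apply/measurable_EFinP; exact: measurable_indic.
    have -> : PX (ysection S y) = \int[PX]_x (\1_(ysection S y) x)%:E.
      by rewrite integral_indic// setIT.
    rewrite -(ge0_integralZl PX measurableT mI) ?lee_fin//.
    apply: eq_integral => x _; rewrite -EFinM mulrC; congr (_ * _)%:E.
    by rewrite !indicE mem_ysection.
  have mSy : measurable (ysection S y) by exact: measurable_ysection.
  rewrite [PX _](dX _ mSy).
  have mG : measurable_fun [set: Rd d] (fun x : Rd d => (\1_(ysection S y) x * f x)%:E).
    by apply/measurable_EFinP; apply: measurable_funM => //; exact: measurable_indic.
  rewrite -integral_RdZl//; last by move=> x; rewrite lee_fin mulr_ge0.
  (* Writing [x = z - y] turns the condition that [x + y] lies in [A] into one on [z] alone. *)
  rewrite -(@integral_Rd_shift _ _ (- y)%R); last 2 first.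
  - by apply: emeasurable_funM => //; exact: measurable_cst.
  - by move=> x; rewrite -EFinM lee_fin !mulr_ge0.
  congr integral_Rd; apply/funext => z; rewrite /F /= -EFinM.
  congr (_ * (_ * _))%:E; rewrite !indicE mem_ysection; congr ((nat_of_bool _)%:R).
  by apply/idP/idP; rewrite !inE /S/= subrK.
rewrite -integral_Rd_exchange//.
congr integral_Rd; apply/funext => z.
rewrite EFinM hE -integral_RdZl//; last 2 first.
- apply/measurable_EFinP; apply: measurable_funM => //.
  by apply: (measurableT_comp mf); exact: measurable_RdB.
- by move=> y; rewrite lee_fin mulr_ge0.
by congr integral_Rd; apply/funext => y; rewrite /F /= -EFinM mulrCA.
Qed.

End law.

(** * Convolution of Student densities *)

Section conv.
Local Open Scope ereal_scope.
Variable R : realType.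
Local Notation leb := (@lebesgue_measure R).
Local Notation Rd := (Rd R).

Lemma sqnorm_ge0 d (x : 'rV[R]_d) : (0 <= sqnorm x)%R.
Proof. by apply: sumr_ge0 => i _; exact: sqr_ge0. Qed.

Lemma student_ge0 d (nu : R) (x : 'rV[R]_d) : (0 < nu)%R -> (0 <= student d nu x)%R.
Proof.
move=> nu0; rewrite /student mulr_ge0 ?powR_ge0// divr_ge0 ?mulr_ge0 ?powR_ge0//.
  by rewrite ltW// Gammaf_gt0// ltr_wpDr// divr_ge0.
by rewrite ltW// Gammaf_gt0.
Qed.

Lemma measurable_student d (nu : R) :
  measurable_fun [set: Rd d] (student d nu : Rd d -> R).
Proof.
apply: measurable_funM => //; apply: (measurableT_comp (measurable_powR _)).
by apply: measurable_funD => //; exact: measurable_sqnorm.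
Qed.

Lemma student_GammaE d (nu : R) (x : 'rV[R]_d) : (0 < nu)%R ->
  (student d nu x)%:E = ((Gammaf nu * pi `^ (d%:R / 2))^-1)%:E *
    \int[leb]_s (pw (nu + d%:R / 2) s * expR (- ((1 + sqnorm x) * s)))%:E.
Proof.
move=> nu0; have a0 : (0 < nu + d%:R / 2)%R by rewrite ltr_wpDr// divr_ge0.
have x0 := sqnorm_ge0 x.
rewrite integral_pw_expR; last by lra.
rewrite GammafK// -!EFinM /student -opprD; congr EFin; ring.
Qed.

Lemma integral_Rd_student d (nu mu : R) (z : 'rV[R]_d) :
  (0 < nu)%R -> (0 < mu)%R ->
  integral_Rd (fun y => (student d mu y * student d nu (z - y))%:E) =
  (Gammaf (nu + mu + d%:R / 2) / (Gammaf nu * Gammaf mu * pi `^ (d%:R / 2)))%:E *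
  \int[leb]_t (pw (mu + d%:R / 2) t * pw (nu + d%:R / 2) (1 - t) *
    (1 + t * (1 - t) * sqnorm z) `^ (- (nu + mu + d%:R / 2)))%:E.
Proof.
move=> nu0 mu0.
pose a := (nu + d%:R / 2)%R; pose b := (mu + d%:R / 2)%R.
pose p := (nu + mu + d%:R / 2)%R; pose r := sqnorm z.
have dge0 : (0 <= d%:R / 2 :> R)%R by rewrite divr_ge0.
have p0 : (0 < p)%R by rewrite /p; lra.
have r0 : (0 <= r)%R by exact: sqnorm_ge0.
pose kap (nu : R) := (Gammaf nu * pi `^ (d%:R / 2))^-1%R.
have kap0 nu' : (0 < nu' -> 0 <= kap nu')%R.
  by move=> ?; rewrite invr_ge0 mulr_ge0 ?powR_ge0// ltW// Gammaf_gt0.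
(* Here [q = (u, s)]: [u] mixes the density taken at [y] and [s] the one taken at [z - y]. The
   kernel [K] below takes the pair in the order [(s, u)]. *)
pose e (y : 'rV[R]_d) (q : R * R) :=
  expR (- ((1 + sqnorm y) * q.1) - (1 + sqnorm (z - y)) * q.2)%R.
pose J (q : (R * R) * Rd d) : \bar R := (pw b q.1.1 * pw a q.1.2 * e q.2 q.1)%:E.
have J0 q : 0 <= J q by rewrite lee_fin !mulr_ge0 ?pw_ge0 ?expR_ge0.
have mJ : measurable_fun [set: (R * R) * Rd d] J.
  apply/measurable_EFinP; apply: measurable_funM.
    by apply: measurable_funM; apply: measurable_pw_comp; exact: measurableT_comp.
  apply: measurableT_comp => //; apply: measurable_funB.
    apply: measurable_funN; apply: measurable_funM; last exact: measurableT_comp.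
    apply: measurable_funD => //.
    by apply: (measurableT_comp (@measurable_sqnorm _ _)).
  apply: measurable_funM; last exact: measurableT_comp.
  apply: measurable_funD => //.
  by apply: (measurableT_comp (@measurable_sqnorm _ _)); exact: measurable_RdB.
pose f1 (q : R * Rd d) := \int[leb]_s J ((q.1, s), q.2).
have f10 q : 0 <= f1 q by exact: integral_ge0.
have mf1 : measurable_fun [set: R * Rd d] f1.
  apply: (measurable_fun_fubini_tonelli_F (m2 := leb)
    (fun q : (R * Rd d) * measurableTypeR R => J ((q.1.1, q.2), q.1.2))) => //.
  apply: (measurableT_comp mJ); apply: measurable_fun_pair; last exact: measurableT_comp.
  by apply: measurable_fun_pair => //; exact: measurableT_comp.
have studE y : (student d mu y * student d nu (z - y))%:E =
    (kap mu * kap nu)%:E * \int[leb]_u f1 (u, y).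
  have m1 c x : measurable_fun [set: R]
      (fun s => (pw c s * expR (- ((1 + sqnorm (x : 'rV[R]_d)) * s)))%:E).
    apply/measurable_EFinP; apply: measurable_funM; first exact: measurable_pw.
    by apply: measurableT_comp => //; apply: measurable_funN; exact: measurable_funM.
  have p1 c x s : 0 <= (pw c s * expR (- ((1 + sqnorm (x : 'rV[R]_d)) * s)))%:E.
    by rewrite lee_fin mulr_ge0 ?pw_ge0 ?expR_ge0.
  rewrite EFinM !student_GammaE// -/(kap _) -/(kap _) muleACA -EFinM; congr (_ * _).
  rewrite -(ge0_integralZr leb measurableT (m1 b y) (fun u _ => p1 b y u)); last first.
    by apply: integral_ge0 => s _; exact: p1.
  apply: eq_integral => u _; rewrite /f1/=.
  rewrite -(ge0_integralZl leb measurableT (m1 a (z - y)%R) (fun s _ => p1 a _ s))//.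
  apply: eq_integral => s _; rewrite -EFinM /J /e /= expRD; congr EFin; ring.
transitivity (integral_Rd (fun y : Rd d =>
    (kap mu * kap nu)%:E * \int[leb]_u f1 (u, y))).
  by congr integral_Rd; apply/funext => y; exact: studE.
rewrite integral_RdZl ?mulr_ge0 ?kap0//; last 2 first.
- exact: (measurable_fun_fubini_tonelli_G (m1 := leb) f1 mf1 f10).
- by move=> y; exact: integral_ge0.
transitivity ((kap mu * kap nu)%:E *
    \int[leb]_u \int[leb]_s integral_Rd (fun y => J ((u, s), y))).
  congr (_ * _); rewrite -(@integral_Rd_tonelli _ _ _ leb d f1 mf1 f10).
  apply: eq_integral => u _; apply/esym.
  apply: (@integral_Rd_tonelli _ _ _ leb d (fun q => J ((u, q.1), q.2))) => //.
  apply: (measurableT_comp mJ); apply: measurable_fun_pair => //.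
  exact: measurable_fun_pair.
(* The Gaussian convolution in closed form, times exp(-(s + u)). Square root and inverse are written
   as real powers; the values at nonpositive [s] or [u] are irrelevant, since the weights [pw]
   vanish there. *)
pose K (q : R * R) : \bar R := (expR (- (q.1 + q.2)) *
  (pi `^ (d%:R / 2) * (q.1 + q.2) `^ (- (d%:R / 2))) *
  expR (- (q.1 * q.2 * (q.1 + q.2) `^ (- 1) * r)))%:E.
have K0 q : 0 <= K q by rewrite lee_fin !mulr_ge0 ?powR_ge0 ?expR_ge0.
have mK : measurable_fun [set: R * R] K.
  have ma : measurable_fun [set: R * R] (fun q => q.1 + q.2)%R by exact: measurable_funD.
  apply/measurable_EFinP; apply: measurable_funM; first apply: measurable_funM.
  - by apply: measurableT_comp => //; exact: measurable_funN.
  - by apply: measurable_funM => //; exact: (measurableT_comp (measurable_powR _)).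
  - apply: measurableT_comp => //; apply: measurable_funN; apply: measurable_funM => //.
    apply: measurable_funM; first exact: measurable_funM.
    exact: (measurableT_comp (measurable_powR _)).
transitivity ((kap mu * kap nu)%:E *
    \int[leb]_u \int[leb]_s ((pw a s * pw b u)%:E * K (s, u))).
  congr (_ * _); apply: eq_integral => u _; apply: eq_integral => s _.
  have [u0|u0] := ltP 0%R u; last first.
    rewrite [X in X%:E * _](_ : _ = 0)%R ?mul0e; last by rewrite (pw_le0E b u0) mulr0.
    rewrite (_ : (fun y => _) = (fun y => 0%:E * J ((u, s), y))) ?integral_RdZl ?mul0e//.
      by apply: (measurableT_comp mJ); exact: measurable_fun_pair.
    by apply/funext => y; rewrite mul0e /J/= (pw_le0E b u0) !mul0r.
  have [s0|s0] := ltP 0%R s; last first.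
    rewrite [X in X%:E * _](_ : _ = 0)%R ?mul0e; last by rewrite (pw_le0E a s0) mul0r.
    rewrite (_ : (fun y => _) = (fun y => 0%:E * J ((u, s), y))) ?integral_RdZl ?mul0e//.
      by apply: (measurableT_comp mJ); exact: measurable_fun_pair.
    by apply/funext => y; rewrite mul0e /J/= (pw_le0E a s0) mulr0 mul0r.
  transitivity (integral_Rd (fun y : Rd d => (pw a s * pw b u * expR (- (s + u)))%:E *
      (expR (- (u * sqnorm y) - s * sqnorm (z - y)))%:E)).
    congr integral_Rd; apply/funext => y; rewrite -EFinM /J /=.
    have -> : e y (u, s) = (expR (- (s + u)) *
        expR (- (u * sqnorm y) - s * sqnorm (z - y)))%R.
      by rewrite -expRD /e/=; congr expR; ring.
    by congr EFin; ring.
  rewrite integral_RdZl ?mulr_ge0 ?pw_ge0 ?expR_ge0//; last first.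
    apply/measurable_EFinP; apply: measurableT_comp => //.
    apply: measurable_funB.
      apply: measurable_funN; apply: measurable_funM => //.
      exact: measurable_sqnorm.
    apply: measurable_funM => //.
    by apply: (measurableT_comp (@measurable_sqnorm _ _)); exact: measurable_RdB.
  rewrite integral_Rd_gauss// -!EFinM /K/=; congr EFin.
  have su0 : (0 < s + u)%R by rewrite addr_gt0.
  have -> : (Num.sqrt (pi / (s + u)) ^+ d =
      pi `^ (d%:R / 2) * (s + u) `^ (- (d%:R / 2)))%R.
    rewrite -powR12_sqrt ?divr_ge0 ?pi_ge0 ?ltW//.
    rewrite -powR_mulrn ?powR_ge0// -powRrM powRM ?pi_ge0 ?invr_ge0 ?ltW//.
    rewrite [(2^-1 * _)%R]mulrC; congr (_ * _)%R.
    by rewrite -(powR_inv1 (ltW su0)) -powRrM mulN1r.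
  rewrite powR_inv1 ?ltW//; ring.
rewrite (integral_pw_polar a b mK K0).
pose w t := (pw b t * pw a (1 - t))%R.
have w0 t : (0 <= w t)%R by rewrite mulr_ge0 ?pw_ge0.
have mw : measurable_fun [set: R] w by exact: measurable_pw_onem.
(* With s + u = l one has s u / (s + u) = l t (1 - t), and the Gaussian factor l^(-d/2) lowers the
   exponent [a + b] to [p]. *)
pose G (q : R * R) : \bar R := (w q.2 * (pi `^ (d%:R / 2) *
  (pw p q.1 * expR (- ((1 + q.2 * (1 - q.2) * r) * q.1)))))%:E.
have G0 q : 0 <= G q by rewrite lee_fin !mulr_ge0 ?pw_ge0 ?powR_ge0 ?expR_ge0.
have mG : measurable_fun [set: R * R] G.
  apply/measurable_EFinP; apply: measurable_funM; first exact: measurableT_comp.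
  apply: measurable_funM => //; apply: measurable_funM; first exact: measurable_pw_comp.
  apply: measurableT_comp => //; apply: measurable_funN; apply: measurable_funM => //.
  apply: measurable_funD => //; apply: measurable_funM => //.
  by apply: measurable_funM => //; exact: measurable_funB.
transitivity ((kap mu * kap nu)%:E * \int[leb]_l \int[leb]_t G (l, t)).
  congr (_ * _); apply: eq_integral => l _.
  have [l0|l0] := ltP 0%R l; last first.
    rewrite pw_le0E// mul0e integral0_eq// => t _.
    by rewrite /G/= [pw p _]pw_le0E// mul0r !mulr0.
  have mI : measurable_fun [set: R]
      (fun t => (w t)%:E * K (l - l * t, l * t)%R).
    apply: emeasurable_funM; first by apply/measurable_EFinP.
    apply: (measurableT_comp mK); apply: measurable_fun_pair; last exact: measurable_funM.
    by apply: measurable_funB => //; exact: measurable_funM.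
  have I0 t : 0 <= (w t)%:E * K (l - l * t, l * t)%R by rewrite mule_ge0// lee_fin.
  have c0 : 0 <= (pw (a + b) l)%:E by rewrite lee_fin pw_ge0.
  rewrite -(ge0_integralZl leb measurableT mI (fun t _ => I0 t) c0).
  apply: eq_integral => t _; rewrite /K /G /= -!EFinM; congr EFin.
  rewrite subrK (powR_inv1 (ltW l0)).
  rewrite (_ : pw p l = pw (a + b) l * l `^ (- (d%:R / 2)))%R; last first.
    rewrite (_ : l `^ _ = pw (1 - d%:R / 2) l)%R; last first.
      by rewrite pw_gt0E//; congr (_ `^ _)%R; ring.
    by rewrite pwM; congr pw; rewrite /p /a /b; field.
  rewrite (_ : - ((1 + t * (1 - t) * r) * l) = - l + - ((l - l * t) * (l * t) / l * r))%R.
    by rewrite expRD; ring.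
  by field; rewrite gt_eqF.
rewrite (fubini_tonelli (m1 := leb) (m2 := leb) G)//.
pose c t := ((1 + t * (1 - t) * r) `^ (- p))%R.
have mc : measurable_fun [set: R] (fun t => (w t * c t)%:E).
  apply/measurable_EFinP; apply: measurable_funM => //.
  apply: (measurableT_comp (measurable_powR _)).
  apply: measurable_funD => //; apply: measurable_funM => //.
  by apply: measurable_funM => //; exact: measurable_funB.
have wc0 t : 0 <= (w t * c t)%:E by rewrite lee_fin mulr_ge0 ?powR_ge0.
have pG0 : (0 <= pi `^ (d%:R / 2) * Gammaf p)%R.
  by rewrite mulr_ge0 ?powR_ge0// ltW// Gammaf_gt0.
transitivity ((kap mu * kap nu)%:E *
    \int[leb]_t ((pi `^ (d%:R / 2) * Gammaf p)%:E * (w t * c t)%:E)).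
  congr (_ * _); apply: eq_integral => t _.
  (* Outside []0, 1[] the weight vanishes; inside, [1 + t * (1 - t) * r] is positive, as the Gamma
     integral in [l] requires. *)
  rewrite [in RHS]/w; have [t0|t0] := ltP 0%R t; last first.
    rewrite (pw_le0E b t0) !mul0r mule0 integral0_eq// => l _.
    by rewrite /G/= /w (pw_le0E b t0) !mul0r.
  have [t1|t1] := ltP t 1%R; last first.
    have t1' : (1 - t <= 0)%R by lra.
    rewrite (pw_le0E a t1') mulr0 !mul0r mule0 integral0_eq// => l _.
    by rewrite /G/= /w (pw_le0E a t1') mulr0 !mul0r.
  have c0 : (0 < 1 + t * (1 - t) * r)%R.
    by rewrite ltr_wpDr// mulr_ge0// mulr_ge0 ?subr_ge0// ltW.
  transitivity (\int[leb]_l ((w t * pi `^ (d%:R / 2))%:E *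
      (pw p l * expR (- ((1 + t * (1 - t) * r) * l)))%:E)).
    by apply: eq_integral => l _; rewrite /G/= -EFinM mulrA.
  rewrite ge0_integralZl//; last 3 first.
  - apply/measurable_EFinP; apply: measurable_funM; first exact: measurable_pw.
    by apply: measurableT_comp => //; apply: measurable_funN; exact: measurable_funM.
  - by move=> l _; rewrite lee_fin mulr_ge0 ?pw_ge0 ?expR_ge0.
  - by rewrite lee_fin mulr_ge0 ?powR_ge0.
  rewrite integral_pw_expR// GammafK// -!EFinM /c /w; congr EFin; ring.
rewrite (ge0_integralZl leb measurableT mc (fun t _ => wc0 t)) ?lee_fin//.
rewrite muleA -EFinM; congr (_%:E * _).
have G1 : (Gammaf nu != 0)%R by rewrite gt_eqF// Gammaf_gt0.
have G2 : (Gammaf mu != 0)%R by rewrite gt_eqF// Gammaf_gt0.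
have G3 : (pi `^ (d%:R / 2) != 0 :> R)%R by rewrite gt_eqF// powR_gt0// pi_gt0.
rewrite /kap; move: (Gammaf nu) (Gammaf mu) (Gammaf p) (pi `^ _)%R G1 G2 G3.
by move=> x1 x2 x3 x4 G1 G2 G3; field; rewrite G1 G2 G3.
Qed.

End conv.

(** * Series expansion *)

Section mixture.
Local Open Scope ereal_scope.
Local Opaque Gammaf Betaf.
Variable R : realType.
Local Notation leb := (@lebesgue_measure R).

Definition betamoment (b a : R) (n : nat) : R :=
  fine (\int[leb]_t (pw b t * pw a (1 - t) * (1 - t + t ^+ 2) ^+ n)%:E).

Lemma measurable_betamoment (b a : R) n : measurable_fun [set: R]
  (fun t => (pw b t * pw a (1 - t) * (1 - t + t ^+ 2) ^+ n)%:E).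
Proof.
apply/measurable_EFinP; apply: measurable_funM; first exact: measurable_pw_onem.
apply: measurable_funX; apply: measurable_funD; first exact: measurable_funB.
exact: measurable_funX.
Qed.

Lemma onemD_sqr_gt0 (t : R) : (0 < 1 - t + t ^+ 2)%R.
Proof. have := sqr_ge0 (t - 1 / 2)%R; nra. Qed.

(** On []0, 1[] the base 1 - t + t^2 lies between 0 and 1, so the Beta integral dominates every
    moment. *)
Lemma betamoment_fin (b a : R) n : (0 < b)%R -> (0 < a)%R ->
  \int[leb]_t (pw b t * pw a (1 - t) * (1 - t + t ^+ 2) ^+ n)%:E =
  (betamoment b a n)%:E.
Proof.
move=> b0 a0; rewrite /betamoment fineK// ge0_fin_numE; last first.
  apply: integral_ge0 => t _.
  by rewrite lee_fin !mulr_ge0 ?pw_ge0// exprn_ge0// ltW// onemD_sqr_gt0.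
apply: (@le_lt_trans _ _ (BetaE b a)); last by rewrite BetafK// ltry.
apply: ge0_le_integral => //.
- by move=> t _; rewrite lee_fin !mulr_ge0 ?pw_ge0// exprn_ge0// ltW// onemD_sqr_gt0.
- exact: measurable_betamoment.
- by apply/measurable_EFinP; exact: measurable_pw_onem.
move=> t _; rewrite lee_fin.
have [t0|t0] := ltP 0%R t; last by rewrite (pw_le0E b t0) !mul0r.
have [t1|t1] := ltP t 1%R; last first.
  by rewrite [pw a _]pw_le0E ?subr_le0// mulr0 mul0r.
rewrite ler_piMr ?mulr_ge0 ?pw_ge0// exprn_ile1//; first exact/ltW/onemD_sqr_gt0.
nra.
Qed.

Lemma betamoment_gt0 (b a : R) n : (0 < b)%R -> (0 < a)%R ->
  (0 < betamoment b a n)%R.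
Proof.
move=> b0 a0; rewrite -lte_fin -betamoment_fin//.
apply: integral_gt0; first exact: measurable_betamoment.
  by move=> t; rewrite lee_fin !mulr_ge0 ?pw_ge0// exprn_ge0// ltW// onemD_sqr_gt0.
move=> t /andP[t0 t1]; rewrite lte_fin mulr_gt0 ?exprn_gt0 ?onemD_sqr_gt0//.
by rewrite !pw_gt0E ?subr_gt0// mulr_gt0// powR_gt0// subr_gt0.
Qed.

Lemma Rintegral_betamoment (b a : R) n :
  Rintegral leb `[0%R, 1%R] (fun t => t `^ (b - 1) * (1 - t) `^ (a - 1) *
    (1 - t + t ^+ 2) ^+ n)%R = betamoment b a n.
Proof.
rewrite /Rintegral /betamoment; congr fine.
rewrite integral_itv_bndoo; last first.
  apply/measurable_EFinP; apply: measurable_funTS.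
  apply: measurable_funM.
    apply: measurable_funM; first exact: measurable_powR.
    by apply: (measurableT_comp (measurable_powR _)); exact: measurable_funB.
  apply: measurable_funX; apply: measurable_funD; first exact: measurable_funB.
  exact: measurable_funX.
rewrite integral_mkcond; apply: eq_integral => t _; rewrite patchE.
case: ifPn => [|/negP]; rewrite inE/= in_itv/=.
  by move=> /andP[t0 t1]; rewrite !pw_gt0E// subr_gt0.
move=> /negP; rewrite negb_and -!leNgt => /orP[t0|t1].
  by rewrite pw_le0E ?mul0r.
by rewrite [pw a _]pw_le0E ?mulr0 ?mul0r// subr_le0.
Qed.

Lemma Gamma_term_ge0 (p r c : R) n : (0 < p)%R -> (0 <= r)%R ->
  (0 <= r ^+ n / n`!%:R * c `^ (- (p + n%:R)) * Gammaf (p + n%:R))%R.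
Proof.
move=> p0 r0; apply: mulr_ge0; last by apply/ltW/Gammaf_gt0; rewrite ltr_wpDr.
by apply: mulr_ge0; [rewrite divr_ge0// exprn_ge0|exact: powR_ge0].
Qed.

(** Used twice: with [r] the squared norm, [c = 1 + r] and p = nu + mu + d/2 for the density, and
    with [r = c = 1] and p = d/2 for the sum of the coefficients. *)
Lemma betamoment_series (p r c b a : R) : (0 < p)%R -> (0 <= r <= c)%R ->
  (0 < c)%R -> (0 < b)%R -> (0 < a)%R ->
  \sum_(n <oo) (r ^+ n / n`!%:R * c `^ (- (p + n%:R)) * Gammaf (p + n%:R) *
      betamoment b a n)%:E =
  (Gammaf p)%:E * \int[leb]_t (pw b t * pw a (1 - t) *
      (c - r * (1 - t + t ^+ 2)) `^ (- p))%:E.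
Proof.
move=> p0 /andP[r0 rc] c0 b0 a0.
have Gp0 : (0 <= Gammaf p)%R by rewrite ltW// Gammaf_gt0.
pose k n := (r ^+ n / n`!%:R * c `^ (- (p + n%:R)) * Gammaf (p + n%:R))%R.
have k0 n : (0 <= k n)%R.
  exact: Gamma_term_ge0.
pose F n t := (k n)%:E * (pw b t * pw a (1 - t) * (1 - t + t ^+ 2) ^+ n)%:E.
have m0 n t : 0 <= (pw b t * pw a (1 - t) * (1 - t + t ^+ 2) ^+ n)%:E :> \bar R.
  by rewrite lee_fin !mulr_ge0 ?pw_ge0// exprn_ge0// ltW// onemD_sqr_gt0.
have F0 n t : 0 <= F n t by apply: mule_ge0; [rewrite lee_fin; exact: k0|exact: m0].
transitivity (\int[leb]_t \sum_(n <oo) F n t).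
  rewrite integral_nneseries//; last first.
    move=> n; apply: emeasurable_funM; first exact: measurable_cst.
    exact: measurable_betamoment.
  apply: eq_eseriesr => n _; rewrite /F.
  rewrite (ge0_integralZl leb measurableT (measurable_betamoment b a n)); last 2 first.
  - by move=> t _; exact: m0.
  - by rewrite lee_fin; exact: k0.
  by rewrite betamoment_fin// -EFinM.
have mL : measurable_fun [set: R] (fun t => (pw b t * pw a (1 - t) *
      (c - r * (1 - t + t ^+ 2)) `^ (- p))%:E).
  apply/measurable_EFinP; apply: measurable_funM; first exact: measurable_pw_onem.
  apply: (measurableT_comp (measurable_powR _)).
  apply: measurable_funB => //; apply: measurable_funM => //.
  by apply: measurable_funD; [exact: measurable_funB|exact: measurable_funX].
rewrite -(ge0_integralZl leb measurableT mL); last 2 first.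
- by move=> t _; rewrite lee_fin !mulr_ge0 ?pw_ge0 ?powR_ge0.
- by rewrite lee_fin.
apply: eq_integral => t _.
have [t0|t0] := ltP 0%R t; last first.
  rewrite (pw_le0E b t0) !mul0r mule0 eseries0// => n _ _.
  by rewrite /F (pw_le0E b t0) !mul0r mule0.
have [t1|t1] := ltP t 1%R; last first.
  have t1' : (1 - t <= 0)%R by lra.
  rewrite (pw_le0E a t1') mulr0 !mul0r mule0 eseries0// => n _ _.
  by rewrite /F (pw_le0E a t1') mulr0 !mul0r mule0.
pose v := (r * (1 - t + t ^+ 2))%R.
have vc : (0 <= v < c)%R.
  rewrite /v mulr_ge0 ?(ltW (onemD_sqr_gt0 _))//=.
  have : (0 < t * (1 - t))%R by rewrite mulr_gt0 ?subr_gt0.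
  (* For [r > 0], v = r - r t (1 - t) < r <= c, which stays strict when [r = c]; for [r = 0] the
     claim is [0 < c]. *)
  move: r0 rc c0; rewrite le_eqVlt => /predU1P[<-|]; first by rewrite mul0r.
  by move=> r0 rc c0 tt; nra.
transitivity ((pw b t * pw a (1 - t))%:E *
  \sum_(n <oo) (v ^+ n / n`!%:R * c `^ (- (p + n%:R)) * Gammaf (p + n%:R))%:E).
  rewrite -nneseriesZl; last first.
    move=> n _; rewrite lee_fin; have /andP[v0 _] := vc.
    exact: Gamma_term_ge0.
  apply: eq_eseriesr => n _; rewrite /F /k -!EFinM /v exprMn; congr EFin; ring.
by rewrite Gamma_series// -!EFinM; congr EFin; rewrite /v; ring.
Qed.

Lemma coefE d (nu mu : R) n : coef d nu mu n =
  (1 / Betaf nu mu * (pochhammer (d%:R / 2) n / n`!%:R) *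
   betamoment (mu + d%:R / 2) (nu + d%:R / 2) n)%R.
Proof. by rewrite /coef Rintegral_betamoment. Qed.

Lemma pochhammer_gt0 (a : R) n : (0 < a)%R -> (0 < pochhammer a n)%R.
Proof. by move=> a0; apply: prodr_gt0 => i _; rewrite ltr_wpDr. Qed.

Lemma Betaf_gt0 (a b : R) : (0 < a)%R -> (0 < b)%R -> (0 < Betaf a b)%R.
Proof.
move=> a0 b0; rewrite Betaf_Gammaf//.
by rewrite divr_gt0 ?mulr_gt0 ?Gammaf_gt0// addr_gt0.
Qed.

Lemma coef_gt0 d (nu mu : R) n : (0 < d)%N -> (0 < nu)%R -> (0 < mu)%R ->
  (0 < coef d nu mu n)%R.
Proof.
move=> d0 nu0 mu0; have dp : (0 < d%:R / 2 :> R)%R by rewrite divr_gt0// ltr0n.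
rewrite coefE mulr_gt0 ?betamoment_gt0 ?addr_gt0// mulr_gt0//.
  by rewrite divr_gt0// Betaf_gt0.
by rewrite divr_gt0 ?pochhammer_gt0// ltr0n fact_gt0.
Qed.

Lemma phi_ge0 d n (eta : R) (x : 'rV[R]_d) : (0 < d)%N -> (0 < eta)%R ->
  (0 <= phi d n eta x)%R.
Proof.
move=> d0 eta0; have dp : (0 < d%:R / 2 :> R)%R by rewrite divr_gt0// ltr0n.
rewrite /phi mulr_ge0// ?divr_ge0 ?mulr_ge0 ?powR_ge0 ?exprn_ge0 ?sqnorm_ge0//.
  by rewrite ltW// Gammaf_gt0.
by rewrite ltW// Betaf_gt0// ltr_wpDl.
Qed.

Lemma sum_coef d (nu mu : R) : (0 < d)%N -> (0 < nu)%R -> (0 < mu)%R ->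
  \sum_(n <oo) (coef d nu mu n)%:E = 1.
Proof.
move=> d0 nu0 mu0; pose p : R := (d%:R / 2)%R.
have p0 : (0 < p)%R by rewrite divr_gt0// ltr0n.
have b0 : (0 < mu + p)%R by rewrite addr_gt0.
have a0 : (0 < nu + p)%R by rewrite addr_gt0.
have G0 := Gammaf_gt0 p0; have B0 := Betaf_gt0 nu0 mu0.
have c01 : (0 <= (1 : R) <= (1 : R))%R by rewrite lexx ler01.
have E := betamoment_series p0 c01 ltr01 b0 a0.
(* Dividing by [Gammaf p] turns each [Gammaf (p + n%:R)] of the series into a Pochhammer symbol. *)
transitivity (((Betaf nu mu * Gammaf p)^-1)%:E *
  ((Gammaf p)%:E * BetaE mu nu)); last first.
  rewrite BetafK// muleA -!EFinM; congr EFin.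
  rewrite [X in (_ * X)%R](_ : _ = Betaf nu mu); last first.
    rewrite (Betaf_Gammaf mu0 nu0) (Betaf_Gammaf nu0 mu0) (addrC mu nu).
    by rewrite [in LHS](mulrC (Gammaf mu)).
  move: (Betaf nu mu) (Gammaf p) B0 G0 => x y x0 y0.
  by field; rewrite !gt_eqF.
transitivity (((Betaf nu mu * Gammaf p)^-1)%:E * \sum_(n <oo)
  (1 ^+ n / n`!%:R * 1 `^ (- (p + n%:R)) * Gammaf (p + n%:R) *
      betamoment (mu + p) (nu + p) n)%:E).
  rewrite -nneseriesZl; last first.
    move=> n _; rewrite lee_fin; apply: mulr_ge0; first exact: Gamma_term_ge0.
    exact/ltW/betamoment_gt0.
  apply: eq_eseriesr => n _; rewrite -EFinM coefE -/p; congr EFin.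
  rewrite Gammaf_pochhammer// expr1n powR1.
  have := fact_gt0 n; rewrite -(ltr0n R).
  move: (Betaf nu mu) (Gammaf p) (betamoment _ _ _) (pochhammer _ _) (n`!%:R : R) B0 G0.
  by move=> x y z u w x0 y0 w0; field; rewrite !gt_eqF.
rewrite E; congr (_ * (_ * _)); apply: eq_integral => t _; congr EFin.
have [t0|t0] := ltP 0%R t; last by rewrite (pw_le0E _ t0) (pw_le0E mu t0) !mul0r.
have [t1|t1] := ltP t 1%R; last first.
  have t1' : (1 - t <= 0)%R by lra.
  by rewrite (pw_le0E _ t1') (pw_le0E nu t1') mulr0 mul0r mulr0.
have t1' : (0 < 1 - t)%R by lra.
rewrite (_ : 1 - 1 * (1 - t + t ^+ 2) = t * (1 - t))%R; last by ring.
rewrite powRM ?ltW// mulrACA.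
(* The factor (t (1 - t))^(-d/2) takes d/2 off both exponents and leaves the Beta integral of [mu]
   and [nu]. *)
have H (s x : R) : (0 < s)%R -> (pw (x + p) s * s `^ (- p) = pw x s)%R.
  move=> s0; rewrite !pw_gt0E// -powRD ?(gt_eqF s0) ?implybT//.
  by congr (_ `^ _)%R; ring.
by rewrite (H _ mu t0) (H _ nu t1').
Qed.

(** The constants match term by term: (d/2)_n Gamma(d/2) cancels the Gamma(d/2 + n) inside the Beta
    function of [phi], and Gamma(nu + mu) cancels between the two Beta functions, leaving Gamma(p +
    n) / (Gamma(nu) Gamma(mu) pi^(d/2)). *)
Lemma sum_coef_phi d (nu mu : R) (z : 'rV[R]_d) :
  (0 < d)%N -> (0 < nu)%R -> (0 < mu)%R ->
  \sum_(n <oo) (coef d nu mu n * phi d n (nu + mu) z)%:E =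
  integral_Rd (fun y => (student d mu y * student d nu (z - y))%:E).
Proof.
move=> d0 nu0 mu0; rewrite integral_Rd_student//.
pose h : R := (d%:R / 2)%R; pose p := (nu + mu + h)%R; pose r := sqnorm z.
have h0 : (0 < h)%R by rewrite divr_gt0// ltr0n.
have p0 : (0 < p)%R by rewrite !addr_gt0.
have b0 : (0 < mu + h)%R by rewrite addr_gt0.
have a0 : (0 < nu + h)%R by rewrite addr_gt0.
have r0 : (0 <= r)%R by exact: sqnorm_ge0.
have r10 : (0 < 1 + r)%R by lra.
have rr : (0 <= r <= 1 + r)%R by rewrite r0 lerDr ler01.
have E := betamoment_series p0 rr r10 b0 a0.
rewrite -!/h -!/p -/r.
have G1 := Gammaf_gt0 nu0; have G2 := Gammaf_gt0 mu0.
have P0 : (0 < pi `^ h :> R)%R by rewrite powR_gt0// pi_gt0.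
transitivity (((Gammaf nu * Gammaf mu * pi `^ h)^-1)%:E * \sum_(n <oo)
  (r ^+ n / n`!%:R * (1 + r) `^ (- (p + n%:R)) * Gammaf (p + n%:R) *
      betamoment (mu + h) (nu + h) n)%:E); last first.
  rewrite E muleA; congr (_ * _); first by rewrite muleC -EFinM.
  apply: eq_integral => t _; congr (_ * (_ `^ _))%:E; ring.
rewrite -nneseriesZl; last first.
  move=> n _; rewrite lee_fin; apply: mulr_ge0; first exact: Gamma_term_ge0.
  exact/ltW/betamoment_gt0.
apply: eq_eseriesr => n _; rewrite -EFinM coefE /phi -/h -/r; congr EFin.
have hn0 : (0 < h + n%:R)%R by rewrite ltr_wpDr.
rewrite (addrC n%:R h) (Betaf_Gammaf nu0 mu0) (Betaf_Gammaf (addr_gt0 nu0 mu0) hn0).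
rewrite (_ : nu + mu + n%:R + h = p + n%:R)%R; last by rewrite /p; ring.
rewrite (_ : nu + mu + (h + n%:R) = p + n%:R)%R; last by rewrite /p; ring.
rewrite (Gammaf_pochhammer n h0) powRN.
have := fact_gt0 n; rewrite -(ltr0n R) => F0.
have G3 := Gammaf_gt0 h0; have G4 : (0 < Gammaf (nu + mu))%R by rewrite Gammaf_gt0// addr_gt0.
have G5 : (0 < Gammaf (p + n%:R))%R by rewrite Gammaf_gt0// ltr_wpDr.
have G6 := pochhammer_gt0 n h0.
have G7 : (0 < (1 + r) `^ (p + n%:R))%R by rewrite powR_gt0.
move: G1 G2 G3 G4 G5 G6 G7 P0 F0.
move: (Gammaf nu) (Gammaf mu) (Gammaf h) (Gammaf (nu + mu)) (Gammaf (p + n%:R))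
  (pochhammer h n) ((1 + r) `^ _)%R (pi `^ h)%R (n`!%:R : R) (betamoment _ _ _) (r ^+ n)%R.
move=> x1 x2 x3 x4 x5 x6 x7 x8 x9 x10 x11 G1 G2 G3 G4 G5 G6 G7 G8 G9.
by field; rewrite !gt_eqF.
Qed.

(** On []0, 1[] the base 1 + t (1 - t) |z|^2 is at least 1, so its negative power is at most 1 and a
    Beta integral dominates. The bound holds at every [z], as pointwise convergence of the series
    demands. *)
Lemma integral_Rd_student_lty d (nu mu : R) (z : 'rV[R]_d) :
  (0 < nu)%R -> (0 < mu)%R ->
  integral_Rd (fun y => (student d mu y * student d nu (z - y))%:E) < +oo.
Proof.
move=> nu0 mu0; rewrite integral_Rd_student//.
have r0 := sqnorm_ge0 z.
have b0 : (0 < mu + d%:R / 2)%R by rewrite ltr_wpDr// divr_ge0.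
have a0 : (0 < nu + d%:R / 2)%R by rewrite ltr_wpDr// divr_ge0.
have p0 : (0 < nu + mu + d%:R / 2)%R by rewrite ltr_wpDr ?divr_ge0// addr_gt0.
apply: lte_mul_pinfty => //.
  rewrite lee_fin divr_ge0 ?mulr_ge0 ?powR_ge0// ltW// Gammaf_gt0//.
apply: (@le_lt_trans _ _ (BetaE (mu + d%:R / 2) (nu + d%:R / 2))%R); last first.
  by rewrite BetafK// ltry.
apply: ge0_le_integral => //.
- by move=> t _; rewrite lee_fin !mulr_ge0 ?pw_ge0 ?powR_ge0.
- apply/measurable_EFinP; apply: measurable_funM; first exact: measurable_pw_onem.
  apply: (measurableT_comp (measurable_powR _)).
  apply: measurable_funD => //; apply: measurable_funM => //.
  by apply: measurable_funM => //; exact: measurable_funB.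
- by apply/measurable_EFinP; exact: measurable_pw_onem.
move=> t _; rewrite lee_fin.
have [t0|t0] := ltP 0%R t; last by rewrite (pw_le0E _ t0) !mul0r.
have [t1|t1] := ltP t 1%R; last first.
  by rewrite [pw (nu + _) _]pw_le0E ?subr_le0// mulr0 mul0r.
rewrite ler_piMr ?mulr_ge0 ?pw_ge0// powRN invf_le1; last first.
  by rewrite powR_gt0// ltr_wpDr// mulr_ge0// mulr_ge0 ?subr_ge0// ltW.
rewrite -[leLHS](powRr0 (1 + t * (1 - t) * sqnorm z)) ler_powR//; last exact: ltW.
by rewrite lerDl mulr_ge0// mulr_ge0 ?subr_ge0// ltW.
Qed.

(** The passage from extended-real sums to real series: a finite total bounds the nondecreasing
    partial sums. *)
Lemma series_EFin_cvg (u : nat -> R) (l : R) : (forall n, 0 <= u n)%R ->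
  \sum_(n <oo) (u n)%:E = l%:E -> series u @ \oo --> l.
Proof.
move=> u0 ul; have cu : cvgn (series u).
  by apply: nnseries_is_cvg => //; rewrite ul ltry.
suff -> : l = limn (series u) by [].
apply: EFin_inj; rewrite -ul -EFin_lim//; congr (limn _).
by apply/funext => n /=; rewrite sumEFin.
Qed.

End mixture.

Theorem theorem3 (R : realType) (d : nat) (nu mu : R)
  (d0 : measure_display) (Omega : measurableType d0) (P : probability Omega R)
  (T1 T2 : Omega -> 'rV[R]_d) :
  (0 < d)%N -> 0 < nu -> 0 < mu ->
  has_density_Rd P T1 (student d nu) ->
  has_density_Rd P T2 (student d mu) ->
  independent_Rd P T1 T2 ->
  (forall x : 'rV[R]_d,
     cvgn (series (fun n => coef d nu mu n * phi d n (nu + mu) x))) /\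
  has_density_Rd P (fun w => T1 w + T2 w)
    (fun x => limn (series (fun n => coef d nu mu n * phi d n (nu + mu) x))) /\
  (forall n, 0 < coef d nu mu n) /\
  series (coef d nu mu) @ \oo --> (1 : R).
Proof.
move=> dp nu0 mu0 dT1 dT2 indep.
pose u x n := coef d nu mu n * phi d n (nu + mu) x.
have cu x : series (u x) @ \oo --> fine (\sum_(n <oo) (u x n)%:E)%E.
  have u0 n : 0 <= u x n.
    by rewrite mulr_ge0 ?phi_ge0 ?addr_gt0// ltW// coef_gt0.
  apply: series_EFin_cvg => //; rewrite fineK// ge0_fin_numE.
    by rewrite sum_coef_phi//; exact: integral_Rd_student_lty.
  by apply: nneseries_ge0 => n _ _; rewrite lee_fin.
split; first by move=> x; apply/cvg_ex; eexists; exact: cu.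
split; last split; first last.
- apply: series_EFin_cvg; first by move=> n; rewrite ltW// coef_gt0.
  exact: sum_coef.
- by move=> n; exact: coef_gt0.
apply: has_density_RdD dT1 dT2 indep _.
- exact: measurable_student.
- by move=> x; exact: student_ge0.
- exact: measurable_student.
- by move=> x; exact: student_ge0.
move=> z; rewrite -sum_coef_phi// (cvg_lim _ (cu z))// fineK//.
rewrite ge0_fin_numE.
  by rewrite sum_coef_phi//; exact: integral_Rd_student_lty.
apply: nneseries_ge0 => n _ _.
by rewrite lee_fin mulr_ge0 ?phi_ge0 ?addr_gt0// ltW// coef_gt0.
Qed.
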